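(* Let $(M^n,H)$ be a Heisenberg manifold and $(X_1,\ldots,X_n)$ an $H$-frame near a point $a\in M$. Then there is a one-to-one correspondence between real symmetric $(n-1)\times(n-1)$-matrices and the nilpotent approximations of $(M,H)$ at $a$ associated with privileged coordinates at $a$ adapted to $(X_1,\ldots,X_n)$.
   Context: A Heisenberg manifold $(M^n,H)$ is an $n$-dimensional smooth manifold $M$ with a distinguished hyperplane bundle $H\subset TM$ (subbundle of rank $n-1$). It is regarded as a Carnot manifold of step $2$ with filtration $(H,TM)$, whose weights are $w_1=\cdots=w_{n-1}=1$, $w_n=2$. An $H$-frame is a local tangent frame $(X_1,\ldots,X_n)$ such that $X_1,\ldots,X_{n-1}$ are sections of $H$. Dilations on $\mathbb{R}^n$: $\delta_t(x)=(tx_1,\ldots,tx_{n-1},t^2x_n)$. Privileged coordinates. For a finite sequence $I=(i_1,\ldots,i_k)$ in $\{1,\ldots,n\}$ set $X_I=X_{i_1}\cdots X_{i_k}$, $\langle I\rangle=w_{i_1}+\cdots+w_{i_k}$. A smooth function $f$ near $a$ has order $N$ at $a$ if $X_If(a)=0$ whenever $\langle I\rangle<N$ and $X_If(a)\ne0$ for some $I$ with $\langle I\rangle=N$. Local coordinates centered at $a$ are privileged coordinates at $a$ adapted to $(X_1,\ldots,X_n)$ if in them $X_j(0)=\partial_j$ for all $j$ and each coordinate function $x_k$ has order $w_k$ at $a$. Nilpotent approximation. In privileged coordinates at $a$ adapted to $(X_1,\ldots,X_n)$, the limits $X_j^{(a)}=\lim_{t\to0}t^{w_j}\delta_t^*X_j$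 exist (all derivatives of coefficients converging uniformly on compact sets), are polynomial vector fields on $\mathbb{R}^n$, and span a nilpotent Lie algebra $\tilde{\mathfrak g}^{(a)}$ of vector fields. Elements of $\tilde{\mathfrak g}^{(a)}$ have complete flows, and $\exp(X):=\exp(tX)(0)|_{t=1}$ (time-one flow from the origin) defines a diffeomorphism $\tilde{\mathfrak g}^{(a)}\to\mathbb{R}^n$. The nilpotent approximation of $(M,H)$ at $a$ associated with these coordinates is the Lie group $G^{(a)}$ given by $\mathbb{R}^n$ with the group law $\exp(X)\cdot\exp(Y)=\exp(X\cdot Y)$, where $X\cdot Y=X+Y+\frac12[X,Y]+\cdots$ is the Dynkin (Baker–Campbell–Hausdorff) product. Nilpotent approximations are thus group structures on $\mathbb{R}^n$, and two of them are regarded as equal when their group laws on $\mathbb{R}^n$ coincide. *)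

(* Defs.v *)
From HB Require Import structures.
From mathcomp Require Import all_boot all_order all_algebra.
From mathcomp Require Import all_classical all_reals all_analysis.

Set Implicit Arguments.
Unset Strict Implicit.
Unset Printing Implicit Defensive.

Import Order.TTheory GRing.Theory Num.Theory.
Import numFieldNormedType.Exports.
Local Open Scope classical_set_scope.
Local Open Scope ring_scope.

(** The ambient dimension is n = m.+1 and the model space R^n is 'rV[R]_m.+1.
    Functions and vector fields defined on an open set only are represented by
    total functions whose values off that open set are irrelevant. *)

Section Smooth.
Context {R : realType} {m : nat} {W : normedModType R}.
Implicit Types (U : set 'rV[R]_m.+1) (f : 'rV[R]_m.+1 -> W).

Definition std (i : 'I_m.+1) : 'rV[R]_m.+1 := delta_mx 0 i.

(** [:: i1; ...; ik] |-> d_i1 (... (d_ik f)) *)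
Definition partials (I : seq 'I_m.+1) f : 'rV[R]_m.+1 -> W :=
  foldr (fun i g => 'D_(std i) g) f I.

Definition smooth_on U f :=
  forall (I : seq 'I_m.+1) x, U x -> differentiable (partials I f) x.

End Smooth.

Section Manifold.
Context {R : realType} {m : nat}.

Record chart (T : topologicalType) := Chart {
  chart_dom : set T;
  chart_map :> T -> 'rV[R]_m.+1;
  chart_inv : 'rV[R]_m.+1 -> T;
  chart_dom_open : open chart_dom;
  chart_img_open : open (chart_map @` chart_dom);
  chart_mapK : {in chart_dom, cancel chart_map chart_inv};
  chart_map_continuous : {within chart_dom, continuous chart_map};
  chart_inv_continuous :
    {within chart_map @` chart_dom, continuous chart_inv} }.

Definition transition (T : topologicalType) (c c' : chart T) :
  'rV[R]_m.+1 -> 'rV[R]_m.+1 := c' \o chart_inv c.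

Definition compatible (T : topologicalType) (c c' : chart T) :=
  smooth_on (c @` (chart_dom c `&` chart_dom c')) (transition c c') /\
  smooth_on (c' @` (chart_dom c `&` chart_dom c')) (transition c' c).

End Manifold.
Arguments chart R m T : clear implicits.

(** Smooth manifold of dimension m.+1. As the atlas is maximal, its elements
    are exactly the systems of local coordinates. *)
Record smoothManifold (R : realType) (m : nat) := SmoothManifold {
  carrier :> topologicalType;
  manifold_hausdorff : hausdorff_space carrier;
  manifold_countable : @second_countable carrier;
  atlas : set (chart R m carrier);
  atlas_cover : forall p, exists2 c, atlas c & chart_dom c p;
  atlas_compatible : forall c c', atlas c -> atlas c' -> compatible c c';
  atlas_maximal : forall c,
    (forall c', atlas c' -> compatible c c') -> atlas c }.

Section Tangent.
Context {R : realType} {m : nat} (M : smoothManifold R m).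

(** A tangent vector at p is the family of its components in all charts around
    p, subject to the transformation law. Components in the other charts are set
    to 0, so that equality of tangent vectors is equality of families and the
    linear structure is that of the function space. *)
Definition components := chart R m M -> 'rV[R]_m.+1.

Definition tangent_space (p : M) : set components := [set v |
  (forall c c', atlas c -> atlas c' -> chart_dom c p -> chart_dom c' p ->
     v c' = 'd (transition c c') (c p) (v c)) /\
  (forall c, ~ (atlas c /\ chart_dom c p) -> v c = 0)].

Definition in_chart (c : chart R m M) (X : M -> components) :
  'rV[R]_m.+1 -> 'rV[R]_m.+1 := fun x => X (chart_inv c x) c.

Definition vector_field (U : set M) (X : M -> components) :=
  (forall p, U p -> tangent_space p (X p)) /\
  (forall c, atlas c -> smooth_on (c @` (chart_dom c `&` U)) (in_chart c X)).

End Tangent.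

Section Span.
Context {R : realType} {V : lmodType R} {k : nat}.

Definition lin_span (e : 'I_k -> V) : set V :=
  [set v | exists x : 'I_k -> R, v = \sum_i x i *: e i].

Definition lin_indep (e : 'I_k -> V) :=
  forall x : 'I_k -> R, \sum_i x i *: e i = 0 -> forall i, x i = 0.

End Span.

(** H is a smooth subbundle of TM of rank m = dim M - 1. *)
Definition hyperplane_bundle (R : realType) (m : nat) (M : smoothManifold R m)
    (H : forall p : M, set (components M)) :=
  forall p : M, exists (U : set M) (Y : 'I_m -> M -> components M),
    [/\ open U, U p, forall i, vector_field U (Y i) &
        forall q, U q -> lin_indep (Y^~ q) /\ H q = lin_span (Y^~ q)].

Record heisenbergManifold (R : realType) (m : nat) := HeisenbergManifold {
  heis_manifold :> smoothManifold R m;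
  heis_bundle : forall p : heis_manifold, set (components heis_manifold);
  heis_bundleP : hyperplane_bundle heis_bundle }.

(** X_1, ..., X_n are indexed by 'I_m.+1; ord_max is the index n. *)
Definition H_frame (R : realType) (m : nat) (M : heisenbergManifold R m)
    (U : set M) (X : 'I_m.+1 -> M -> components M) :=
  [/\ open U, forall j, vector_field U (X j),
      forall p, U p -> lin_indep (X^~ p) &
      forall j p, j != ord_max -> U p -> heis_bundle p (X j p)].

Section Weights.
Context {R : realType} {m : nat}.
Local Notation E := 'rV[R]_m.+1.

Definition weight (j : 'I_m.+1) : nat := if j == ord_max then 2 else 1.

Definition weight_seq (I : seq 'I_m.+1) : nat := (\sum_(j <- I) weight j)%N.

Definition dilation (t : R) (x : E) : E := \row_j (t ^+ weight j * x 0 j).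

(** X_{i1} ( ... (X_{ik} f)) *)
Definition frame_derive (X : 'I_m.+1 -> E -> E) (I : seq 'I_m.+1) (f : E -> R) :
  E -> R := foldr (fun i g x => 'D_(X i x) g x) f I.

Definition has_order (X : 'I_m.+1 -> E -> E) (a : E) (f : E -> R) (N : nat) :=
  (forall I, (weight_seq I < N)%N -> frame_derive X I f a = 0) /\
  (exists2 I, weight_seq I = N & frame_derive X I f a != 0).

(** t^{w_j} delta_t^* X; delta_t is linear with inverse delta_{1/t}. *)
Definition rescaled (j : 'I_m.+1) (X : E -> E) (t : R) : E -> E :=
  fun x => t ^+ weight j *: dilation t^-1 (X (dilation t x)).

(** Y is the limit of t^{w_j} delta_t^* X as t -> 0 (t <> 0): all partial
    derivatives converge uniformly on compact sets. *)
Definition is_rescaling_limit (j : 'I_m.+1) (X Y : E -> E) :=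
  smooth_on setT Y /\
  forall I : seq 'I_m.+1,
    {family compact, (fun t => partials I (rescaled j X t)) @ (0 : R)^' -->
                     partials I Y}.

Definition field_bracket (X Y : E -> E) : E -> E :=
  fun x => 'D_(X x) Y x - 'D_(Y x) X x.

(** y = exp(X): time-one value of the integral curve of X from the origin. *)
Definition is_exp (X : E -> E) (y : E) := exists g : R -> E,
  [/\ g 0 = 0, forall t : R, is_derive t 1 g (X (g t)) & g 1 = y].

End Weights.

Section Dynkin.
Context {R : realType} {L : lmodType R} (bracket : L -> L -> L).

(** [x1, [x2, ... [x_{l-1}, x_l]]] *)
Fixpoint nested_bracket (s : seq L) : L :=
  match s with
  | [::] => 0
  | [:: x] => x
  | x :: s' => bracket x (nested_bracket s')
  end.

(** Homogeneous part of degree d of Dynkin's formula: the sum over k >= 1 and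
    over ((p_1, q_1), ..., (p_k, q_k)) with p_i + q_i >= 1 and total degree d of
    (-1)^{k-1} / (k d prod_i p_i! q_i!) [x^{p_1} y^{q_1} ... x^{p_k} y^{q_k}].
    These constraints force k, p_i, q_i <= d. *)
Definition dynkin_term (d : nat) (x y : L) : L :=
  \sum_(1 <= k < d.+1)
   \sum_(s : k.-tuple ('I_d.+1 * 'I_d.+1)
          | all (fun pq : 'I_d.+1 * 'I_d.+1 => 0 < pq.1 + pq.2)%N s
            && ((\sum_(pq <- s) (pq.1 + pq.2))%N == d))
     ((-1) ^+ k.-1 /
        (k%:R * d%:R * \prod_(pq <- s) (pq.1`! * pq.2`!)%:R)) *:
     nested_bracket (flatten [seq nseq pq.1 x ++ nseq pq.2 y | pq : 'I_d.+1 * 'I_d.+1 <- s]).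

(** In a nilpotent Lie algebra the series has finitely many nonzero terms. *)
Definition is_dynkin_product (x y z : L) :=
  \forall N \near \oo, z = \sum_(1 <= d < N.+1) dynkin_term d x y.

End Dynkin.

Section Nilpotent_approximation.
Context {R : realType} {m : nat} (M : heisenbergManifold R m).
Local Notation E := 'rV[R]_m.+1.
Implicit Types (X : 'I_m.+1 -> M -> components M) (c : chart R m M).

Definition privileged_coordinates (a : M) X c :=
  [/\ atlas c, chart_dom c a /\ c a = 0,
      forall j, in_chart c (X j) 0 = std j &
      forall k, has_order (fun j => in_chart c (X j)) 0 (fun x : E => x 0 k)
                          (weight k)].

(** mul is the group law exp(u) . exp(v) = exp(u . v), where u and v range over
    the Lie algebra spanned by the model fields Y_1, ..., Y_n. *)
Definition is_nilpotent_approximation X c (mul : E -> E -> E) :=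
  exists2 Y : 'I_m.+1 -> E -> E,
    forall j, is_rescaling_limit j (in_chart c (X j)) (Y j) &
    forall x y z, mul x y = z <->
      exists u v w : E -> E,
        [/\ lin_span Y u, lin_span Y v, lin_span Y w &
            [/\ is_exp u x, is_exp v y, is_dynkin_product field_bracket u v w &
                is_exp w z]].

Definition nilpotent_approximations (a : M) X : set (E -> E -> E) :=
  [set mul | exists2 c, privileged_coordinates a X c &
                        is_nilpotent_approximation X c mul].

End Nilpotent_approximation.

(* Main.v *)
(** In step 2 a chart centered at [a] is privileged as soon as the frame is the
    standard one at the origin. Rescaling then keeps of [X_j] (j < n) only
    [d_j + (\sum_k B_jk x_k) d_n], where [B_jk] is the derivative along [x_k] at
    0 of the n-th component of [X_j], and of [X_n] only [d_n]. The flows of these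
    affine fields are explicit and the Dynkin series stops after one bracket,
    which gives the law [x . y = x + y + (\sum_jk y_j B_jk x_k) e_n]; it
    determines [B] and is determined by it. Changing privileged coordinates adds
    to [B] the Hessian at 0 of the n-th component of the transition map, a
    symmetric matrix by Schwarz' theorem, and every symmetric [Q] is obtained by
    shearing [x_n] by [(1/2) \sum_jk Q_jk x_j x_k]. *)

Require Import Defs.
From HB Require Import structures.
From mathcomp Require Import all_boot all_order all_algebra.
From mathcomp Require Import all_classical all_reals all_analysis.
From mathcomp Require Import ring lra.

Set Implicit Arguments.
Unset Strict Implicit.
Unset Printing Implicit Defensive.

Import Order.TTheory GRing.Theory Num.Theory.
Import numFieldNormedType.Exports.
Local Open Scope classical_set_scope.
Local Open Scope ring_scope.

(** * Smooth functions on open sets *)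

(** No privileged chart is distinguished, so the correspondence needs a base point: the matrices [B]
    of all privileged charts form one coset of the symmetric matrices, and fixing one such chart
    identifies this coset with the symmetric matrices. That a privileged chart exists is a step of
    its own: any chart at [a] is corrected by the affine map that makes the frame standard there.

    Two features of the encoding shape the rest. Charts, transitions and fields are total functions
    with arbitrary values off an open set, so smoothness is always relative to an open set and
    derivatives are compared through equality near a point. And [field_bracket] acts on all maps,
    where it is not nilpotent; the Dynkin product is therefore computed on coefficient vectors and
    transported to fields by [model_field], which is linear and injective. *)

Lemma near_eq_differentiable (R : numFieldType) (V W : normedModType R)
    (f g : V -> W) (x : V) :
  (\near x, f x = g x) -> differentiable f x -> differentiable g x.
Proof.
move=> fg df; have fgx : f x = g x := nbhs_singleton fg.
have H : g \o shift x = cst (g x) + 'd f x +o_ 0 id.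
  apply/eqaddoP => e e0.
  have /eqaddoP /(_ e e0) := diff_locally df.
  have : \forall h \near 0, f (h + x) = g (h + x).
    by move: fg; rewrite [X in X -> _](near_shift 0) subr0.
  apply: filterS2 => h /= E; rewrite -fgx.
  by rewrite !fctE /= /shift /= -E.
have C : continuous ('d f x) by apply: diff_continuous.
by apply/diff_locallyP; rewrite (diff_unique C H).
Qed.

Section Calculus.
Context {R : realType} {m : nat}.
Local Notation E := 'rV[R]_m.+1.

Lemma rV_sum_std (x : E) : x = \sum_k x 0 k *: std k.
Proof. by rewrite {1}[x]row_sum_delta. Qed.

Lemma stdE (i j : 'I_m.+1) : (std i : E) 0 j = (j == i)%:R.
Proof. by rewrite mxE eqxx. Qed.

Lemma linear_rVE (W : lmodType R) (f : {linear E -> W}) x :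
  f x = \sum_k x 0 k *: f (std k).
Proof.
rewrite {1}[x]rV_sum_std linear_sum.
by apply: eq_bigr => i _; rewrite linearZ.
Qed.

Lemma linear_rV_differentiable (W : normedModType R) (f : {linear E -> W}) x :
  differentiable f x.
Proof.
have -> : (f : E -> W) = \sum_k (fun x : E => x 0 k *: f (std k)).
  by apply/funext => y; rewrite linear_rVE fct_sumE.
apply: differentiable_sum => k; apply: differentiableZl.
exact: differentiable_coord.
Qed.

Lemma linear_rV_continuous (W : normedModType R) (f : {linear E -> W}) :
  continuous f.
Proof. move=> x; exact/differentiable_continuous/linear_rV_differentiable. Qed.

Lemma diff_linear_rV (W : normedModType R) (f : {linear E -> W}) x :
  'd f x = f :> (E -> W).
Proof. exact/diff_lin/linear_rV_continuous. Qed.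

Lemma derive_linear_rV (W : normedModType R) (f : {linear E -> W}) x v :
  'D_v f x = f v.
Proof. by rewrite deriveE ?diff_linear_rV//; exact: linear_rV_differentiable. Qed.

Lemma differentiable_rVP (V : normedModType R) (f : V -> E) x :
  differentiable f x <-> forall k, differentiable (fun y => f y 0 k) x.
Proof.
split=> [df k|df].
  by apply: (@differentiable_comp _ _ _ _ f (fun y : E => y 0 k)) => //;
    exact: differentiable_coord.
have -> : f = \sum_k (fun y => f y 0 k *: std k).
  by apply/funext => y; rewrite fct_sumE {1}[f y]rV_sum_std.
by apply: differentiable_sum => k; apply: differentiableZl.
Qed.

Lemma derive_coord (V : normedModType R) (f : V -> E) x v k :
  derivable f x v -> ('D_v f x) 0 k = 'D_v (fun y => f y 0 k) x.
Proof. by move=> df; rewrite derive_mx// mxE. Qed.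

Lemma derive_rV (W : normedModType R) (f : E -> W) x v :
  differentiable f x -> 'D_v f x = \sum_k v 0 k *: 'D_(std k) f x.
Proof.
move=> df; rewrite deriveE// linear_rVE.
by apply: eq_bigr => k _; rewrite deriveE.
Qed.

Lemma derive_comp (V V' W : normedModType R) (f : V -> V') (g : V' -> W) x v :
  differentiable f x -> differentiable g (f x) ->
  'D_v (g \o f) x = 'D_('D_v f x) g (f x).
Proof.
move=> df dg; rewrite !deriveE//; last exact: differentiable_comp.
by rewrite diff_comp.
Qed.

(** Smoothness of order [n], splitting off the innermost derivative. Unlike differentiability of one
    fixed word of partials, it passes through products and compositions by induction on [n]. *)
Fixpoint Ck (W : normedModType R) n (U : set E) (f : E -> W) : Prop :=
  if n is n'.+1 then
    (forall x, U x -> differentiable f x) /\ forall i, Ck n' U ('D_(std i) f)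
  else True.

(** The head of a word is the outermost derivative, so the derivative taken first is the last
    letter: hence [rcons]. *)
Lemma smooth_onS (W : normedModType R) (U : set E) (f : E -> W) :
  smooth_on U f <-> (forall x, U x -> differentiable f x) /\
                    forall i, smooth_on U ('D_(std i) f).
Proof.
split=> [sf|[df sf] I].
  split=> [x Ux|i I x Ux]; first exact: (sf [::]).
  have := sf (rcons I i) x Ux.
  by rewrite /partials foldr_rcons.
by case/lastP: I => [|I i]; rewrite ?/partials ?foldr_rcons; [exact: df|exact: sf].
Qed.

Lemma smooth_Ck (W : normedModType R) (U : set E) (f : E -> W) :
  smooth_on U f <-> forall n, Ck n U f.
Proof.
split=> [sf n|cf I].
  elim: n f sf => [//|n IH] f /smooth_onS[df sf]; split=> // i.
  exact: IH.
have := cf (size I).+1.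
elim/last_ind: I f {cf} => [|I i IH] f /=; first by case.
rewrite /partials foldr_rcons size_rcons => -[df cf].
exact: IH.
Qed.

Lemma eq_Ck (W : normedModType R) n (U : set E) (f g : E -> W) :
  open U -> (forall x, U x -> f x = g x) -> Ck n U f -> Ck n U g.
Proof.
move=> oU; elim: n f g => [//|n IH] f g fg [df cf].
have fgn x : U x -> \near x, f x = g x.
  by move=> Ux; apply: filterS (open_nbhs_nbhs (conj oU Ux)).
split=> [x Ux|i]; first exact: near_eq_differentiable (fgn _ Ux) (df _ Ux).
apply: IH (cf i) => x Ux; exact/near_eq_derive/fgn.
Qed.

Lemma sub_smooth (W : normedModType R) (U U' : set E) (f : E -> W) :
  U' `<=` U -> smooth_on U f -> smooth_on U' f.
Proof. by move=> s sf I x /s; exact: sf. Qed.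

Lemma Ck_le (W : normedModType R) n n' (U : set E) (f : E -> W) :
  (n <= n')%N -> Ck n' U f -> Ck n U f.
Proof.
elim: n n' f => [//|n IH] [//|n'] f /= le [df cf].
by split=> // i; apply: IH (cf i).
Qed.

Lemma Ck_cst (W : normedModType R) n (U : set E) (a : W) : Ck n U (cst a).
Proof.
elim: n a => [//|n IH] a; split=> [x _|i]; first exact: differentiable_cst.
rewrite (_ : 'D_(std i) _ = cst 0); first exact: IH.
by apply/funext => x; rewrite derive_cst.
Qed.

Lemma Ck_linear (W : normedModType R) n (U : set E) (f : {linear E -> W}) :
  Ck n U f.
Proof.
case: n => [//|n]; split=> [x _|i]; first exact: linear_rV_differentiable.
rewrite (_ : 'D_(std i) _ = cst (f (std i))); first exact: Ck_cst.
by apply/funext => x; rewrite derive_linear_rV.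
Qed.

Lemma Ck_coord n (U : set E) k : Ck n U (fun x : E => x 0 k).
Proof.
have @f : {linear E -> R}.
  by exists (fun N : E => N 0 k); do 2![eexists]; do ?[constructor];
     rewrite ?mxE// => ? *; rewrite ?mxE//; move=> ?; rewrite !mxE.
exact: (Ck_linear n U f).
Qed.

Lemma CkD (W : normedModType R) n (U : set E) (f g : E -> W) :
  open U -> Ck n U f -> Ck n U g -> Ck n U (fun x => f x + g x).
Proof.
move=> oU; elim: n f g => [//|n IH] f g [df cf] [dg cg].
split=> [x Ux|i]; first by apply: differentiableD; [exact: df|exact: dg].
apply: eq_Ck oU _ (IH _ _ (cf i) (cg i)) => x Ux.
by rewrite deriveD//; apply: diff_derivable; [exact: df|exact: dg].
Qed.

Lemma Ck_sum (W : normedModType R) n p (U : set E) (f : 'I_p -> E -> W) :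
  open U -> (forall k, Ck n U (f k)) -> Ck n U (fun x => \sum_k f k x).
Proof.
move=> oU; elim: p f => [|p IH] f cf.
  rewrite (_ : (fun _ => _) = cst 0); first exact: Ck_cst.
  by apply/funext => x; rewrite big_ord0.
under eq_fun do rewrite big_ord_recr /=.
by apply: CkD => //; exact: IH.
Qed.

(** Leibniz' rule multiplies a derivative of one factor by the other factor itself, which enters the
    induction hypothesis at the lower order through [Ck_le]. *)
Lemma CkM n (U : set E) (f g : E -> R) :
  open U -> Ck n U f -> Ck n U g -> Ck n U (fun x => f x * g x).
Proof.
move=> oU; elim: n f g => [//|n IH] f g cfn cgn.
have [cf' cg'] := (Ck_le (leqnSn n) cfn, Ck_le (leqnSn n) cgn).
case: cfn cgn => [df cf] [dg cg].
split=> [x Ux|i]; first by apply: differentiableM; [exact: df|exact: dg].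
apply: eq_Ck oU _ (CkD oU (IH _ _ cf' (cg i)) (IH _ _ cg' (cf i))) => x Ux.
rewrite deriveM//; apply: diff_derivable; [exact: df|exact: dg].
Qed.

Lemma Ck_rV n (U : set E) (f : E -> E) : open U ->
  Ck n U f <-> forall k, Ck n U (fun x => f x 0 k).
Proof.
move=> oU; elim: n f => [//|n IH] f; split.
  case=> df cf k; split=> [x Ux|i].
    by have /differentiable_rVP := df _ Ux; exact.
  apply: eq_Ck oU _ ((IH _).1 (cf i) k) => x Ux.
  by rewrite derive_coord//; exact/diff_derivable/df.
move=> cf; have df x : U x -> differentiable f x.
  by move=> Ux; apply/differentiable_rVP => k; apply: (cf k).1.
split=> // i; apply/IH => k.
apply: eq_Ck oU _ ((cf k).2 i) => x Ux.
by rewrite derive_coord//; exact/diff_derivable/df.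
Qed.

(** Chain rule: the derivative of [g \o f] along [std i] sums over [k] the derivative of the [k]-th
    component of [f] times ['D_(std k) g \o f]. The induction hypothesis handles the second factors
    and [CkM] the products. *)
Lemma Ck_comp n (U V : set E) (f : E -> E) (g : E -> R) :
  open U -> (forall x, U x -> V (f x)) -> Ck n U f -> Ck n V g ->
  Ck n U (g \o f).
Proof.
move=> oU fUV; elim: n g => [//|n IH] g cfn [dg cg].
have cf' := Ck_le (leqnSn n) cfn.
case: cfn => [df cf].
split=> [x Ux|i]; first by apply: differentiable_comp; [exact: df|exact/dg/fUV].
have := Ck_sum oU (fun k => CkM oU ((Ck_rV _ _ oU).1 (cf i) k) (IH _ cf' (cg k))).
apply: eq_Ck oU _ => x Ux.
rewrite (derive_comp _ (df _ Ux) (dg _ (fUV _ Ux))).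
by rewrite (derive_rV _ (dg _ (fUV _ Ux))).
Qed.

Lemma smooth_comp (U V : set E) (f : E -> E) (g : E -> E) :
  open U -> (forall x, U x -> V (f x)) -> open V ->
  smooth_on U f -> smooth_on V g -> smooth_on U (g \o f).
Proof.
move=> oU fUV oV /smooth_Ck cf /smooth_Ck cg; apply/smooth_Ck => n.
apply/Ck_rV => // k; apply: (@Ck_comp n U V f (fun y => g y 0 k)) => //.
exact: (Ck_rV _ _ oV).1.
Qed.

End Calculus.

(** * Symmetry of second derivatives *)

Section Schwarz.
Context {R : realType} {V : normedModType R}.

Lemma differentiable_le (W : normedModType R) (f : V -> W) (a : V) (e : R) :
  differentiable f a -> 0 < e ->
  \forall k \near (0 : V), `|f (a + k) - f a - 'd f a k| <= e * `|k|.
Proof.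
move=> df e0; have /eqaddoP /(_ e e0) := diff_locally df.
apply: filterS => k /=; rewrite !fctE /= /shift /= [k + a]addrC.
by rewrite opprD addrA.
Qed.

(* Mean value theorem for [s |-> f (a + s h u + h v) - f (a + s h u)] on [0, 1]. *)
Lemma second_difference (f : V -> R) (a u v : V) (e : R) :
  (\forall x \near a, differentiable f x) -> differentiable ('D_u f) a ->
  0 < e ->
  \forall h \near (0 : R),
    `|f (a + h *: u + h *: v) - f (a + h *: u) - f (a + h *: v) + f a
       - h ^+ 2 * 'D_v ('D_u f) a| <= e * (2 * `|u| + `|v|) * h ^+ 2.
Proof.
move=> df dg e0; set g : V -> R := 'D_u f.
have : \forall k \near (0 : V), differentiable f (a + k) /\
    `|g (a + k) - g a - 'd g a k| <= e * `|k|.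
  apply: filterI; last exact: differentiable_le.
  by move: df; rewrite [X in X -> _](near_shift 0) subr0 /=;
    apply: filterS => k; rewrite /= addrC.
move=> /nbhs_ballP[r /= r0 rP].
(* All points [a + s h u + t h v] with [s], [t] in [0, 1] must stay in the ball of radius [r] where
   the expansion of [g] is controlled; the [+ 1] keeps the divisor positive. *)
have C0 : 0 < `|u| + `|v| + 1 by rewrite ltr_wpDl// addr_ge0.
exists (r / (`|u| + `|v| + 1)) => /=; first by rewrite divr_gt0.
move=> h /=; rewrite sub0r normrN ltr_pdivlMr// => hr.
have small k s t : 0 <= s <= 1 -> 0 <= t <= 1 -> k = (s * h) *: u + (t * h) *: v ->
    differentiable f (a + k) /\ `|g (a + k) - g a - 'd g a k| <= e * `|k|.
  move=> /andP[s0 s1] /andP[t0 t1] ->; apply: rP.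
  rewrite -ball_normE /= sub0r normrN.
  apply: le_lt_trans (ler_normD _ _) _; rewrite !normrZ.
  rewrite (ger0_norm s0) (ger0_norm t0).
  have A1 : s * `|h| * `|u| <= `|h| * `|u|.
    by rewrite ler_wpM2r// ler_piMl.
  have A2 : t * `|h| * `|v| <= `|h| * `|v|.
    by rewrite ler_wpM2r// ler_piMl.
  apply: le_lt_trans hr; rewrite !mulrDr mulr1.
  by rewrite -[leLHS]addr0 lerD// lerD.
pose G (s : R) := f (a + (s *: (h *: u) + h *: v)) - f (a + s *: (h *: u)).
pose dG (s : R) := h * (g (a + (s *: (h *: u) + h *: v)) - g (a + s *: (h *: u))).
have is_der w (s : R) : differentiable f (a + (s *: (h *: u) + w)) ->
    is_derive s (1 : R) (fun s : R => f (a + (s *: (h *: u) + w)))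
      (h * g (a + (s *: (h *: u) + w))).
  move=> d; pose p (s : R) : V := a + (s *: (h *: u) + w).
  have pE : p = (fun s : R => s *: (h *: u)) + cst (a + w).
    by apply/funext => r'; rewrite /p fctE addrCA.
  have ip := is_diff_scalel s (h *: u).
  have dp : differentiable p s.
    by rewrite pE; apply: differentiableD; [exact: ex_diff|exact: differentiable_cst].
  apply: DeriveDef; first exact/diff_derivable/(differentiable_comp dp).
  have Dp : 'D_1 p s = h *: u.
    rewrite pE deriveD; [|exact/diff_derivable/ex_diff|exact: derivable_cst].
    by rewrite derive_cst addr0 deriveE ?diff_val ?scale1r//; exact: ex_diff.
  rewrite (derive_comp (1 : R) dp d) Dp.
  by rewrite deriveE// linearZ /= /g deriveE.
have dG_ (s : R) : 0 <= s <= 1 -> is_derive s (1 : R) G (dG s).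
  move=> s01; rewrite /dG mulrBr; apply: is_deriveB.
    apply: is_der; apply: (small _ s 1 _ _ _).1 => //; first by rewrite ler01 lexx.
    by rewrite scalerA mul1r.
  have := is_der 0 s; rewrite addr0; under eq_fun do rewrite addr0.
  apply; apply: (small _ s 0 _ _ _).1 => //; first by rewrite ler01 lexx.
  by rewrite scalerA mul0r scale0r addr0.
have [s /andP[s0 s1]] : exists2 s, (0 <= s <= 1)%R & G 1 - G 0 = dG s.
  have [||s sI] := @MVT R G dG 0 1 ltr01.
  - move=> s; rewrite in_itv /= => /andP[s0 s1]; apply: dG_.
    by rewrite !ltW.
  - apply: derivable_within_continuous => s; rewrite in_itv /= => s01.
    by have [] := dG_ _ s01.
  - rewrite subr0 mulr1 => GE; exists s => //.
    by move: sI; rewrite in_itv /= => /andP[s0 s1]; rewrite !ltW.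
rewrite /G !scale1r !scale0r !add0r addr0 => GE.
have s01 : 0 <= s <= 1 by rewrite s0.
have o01 : 0 <= (1 : R) <= 1 by rewrite ler01 lexx.
have z01 : 0 <= (0 : R) <= 1 by rewrite ler01 lexx.
have w1 : s *: (h *: u) + h *: v = (s * h) *: u + (1 * h) *: v.
  by rewrite scalerA mul1r.
have w2 : s *: (h *: u) = (s * h) *: u + (0 * h) *: v.
  by rewrite scalerA mul0r scale0r addr0.
have [_ b1] := small _ s 1 s01 o01 w1; have [_ b2] := small _ s 0 s01 z01 w2.
have -> : f (a + h *: u + h *: v) - f (a + h *: u) - f (a + h *: v) + f a = dG s.
  rewrite -GE addrA; lra.
have -> : 'D_v g a = 'd g a v by rewrite deriveE.
rewrite /dG.
have L2 : 'd g a (s *: (h *: u)) = s * (h * 'd g a u) by rewrite !linearZ.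
have L1 : 'd g a (s *: (h *: u) + h *: v) = s * (h * 'd g a u) + h * 'd g a v.
  by rewrite linearD L2 linearZ.
move: b1 b2; rewrite L1 L2.
set g1 : R := g (_ + (_ + _)); set g2 : R := g (a + s *: _).
set Lu : R := 'd g a u; set Lv : R := 'd g a v; set ga : R := g a => b1 b2.
(* The error is [h] times a difference of two expansion remainders, at [s h u + h v] and at [s h u].
   These increments are bounded by [|h| (|u| + |v|)] and [|h| |u|], whence the constant
   [2 |u| + |v|]. *)
have -> : h * (g1 - g2) - h ^+ 2 * Lv =
  h * ((g1 - ga - (s * (h * Lu) + h * Lv)) - (g2 - ga - s * (h * Lu))) by ring.
rewrite normrM.
have n1 : `|s *: (h *: u)| <= `|h| * `|u|.
  by rewrite !normrZ (ger0_norm s0) ler_piMl// mulr_ge0.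
have n2 : `|s *: (h *: u) + h *: v| <= `|h| * `|u| + `|h| * `|v|.
  by rewrite (le_trans (ler_normD _ _))// lerD// normrZ.
rewrite -[h ^+ 2]real_normK ?num_real// expr2 [leRHS]mulrC -[leRHS]mulrA ler_wpM2l//.
apply: le_trans (ler_normB _ _) _.
apply: le_trans (lerD b1 b2) _.
rewrite -mulrDr [leRHS]mulrCA ler_wpM2l ?(ltW e0)//.
apply: le_trans (lerD n2 n1) _; lra.
Qed.

(** The second difference is symmetric in [u] and [v], and its quotient by [h ^+ 2] tends to either
    mixed derivative. *)
Lemma derive_symmetric (f : V -> R) (a u v : V) :
  (\forall x \near a, differentiable f x) ->
  differentiable ('D_u f) a -> differentiable ('D_v f) a ->
  'D_v ('D_u f) a = 'D_u ('D_v f) a.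
Proof.
move=> df du dv; apply/eqP; rewrite -subr_eq0 -normr_le0.
apply/ler_addgt0Pl => e e0; rewrite addr0.
(* Sum of the error constants [2 |u| + |v|] and [2 |v| + |u|], plus 1 for positivity. *)
pose C := 3 * `|u| + 3 * `|v| + 1.
have C0 : 0 < C by rewrite ltr_wpDl// addr_ge0// mulr_ge0.
have eC : 0 < e / C by rewrite divr_gt0.
have H1 := nbhs_dnbhs (second_difference v df du eC).
have H2 := nbhs_dnbhs (second_difference u df dv eC).
have H0 : \forall h \near (0 : R)^', h != 0.
  by rewrite near_withinE; apply: filterE.
have [h [h0 [b1 b2]]] := filter_ex (filterI H0 (filterI H1 H2)).
have h2 : 0 < h ^+ 2 by rewrite exprn_even_gt0.
rewrite -(ler_pM2r h2) -{1}(gtr0_norm h2) -normrM.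
move: b1 b2; rewrite [a + h *: v + _]addrAC.
set D1 := 'D_v _ _; set D2 := 'D_u _ _; set x := f _; set y := f _; set z := f _.
move=> b1 b2.
have -> : (D1 - D2) * h ^+ 2 = (x - z - y + f a - h ^+ 2 * D2) -
   (x - y - z + f a - h ^+ 2 * D1) by ring.
apply: le_trans (ler_normB _ _) _.
apply: le_trans (lerD b2 b1) _.
rewrite -mulrDl ler_wpM2r ?(ltW h2)// -mulrDr mulrAC ler_pdivrMr// ler_wpM2l ?(ltW e0)//.
rewrite (_ : C = 2 * `|v| + `|u| + (2 * `|u| + `|v|) + 1) ?lerDl//.
by rewrite /C; move: (`|u|) (`|v|) => p q; ring.
Qed.

End Schwarz.

(** * Charts and vector fields *)

Lemma within_open_continuousP (T S : topologicalType) (D : set T) (f : T -> S) :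
  open D ->
  {within D, continuous f} <-> forall x, D x -> {for x, continuous f}.
Proof.
move=> oD; have wD x : D x -> within D (nbhs x) = nbhs x.
  move=> Dx; apply: within_interior.
  by have : D `<=` D°; [rewrite -open_subsetE|exact].
split.
  by move=> /subspace_continuousP cf x Dx; have := cf x Dx; rewrite wD.
move=> cf; apply/subspace_continuousP => x Dx; rewrite wD//; exact: cf.
Qed.

(** Affine maps, shears, model fields and their integral curves all have degree at most 2 along
    lines; the exact expansion yields existence and value of the derivative together. *)
Lemma is_derive_quadratic (R : realType) (V W : normedModType R) (f : V -> W)
    (x v : V) (a b : W) :
  (forall h : R, f (h *: v + x) = f x + h *: a + h ^+ 2 *: b) ->
  is_derive x v f a.
Proof.
move=> fE.
have cv : (fun h : R => h^-1 *: ((f \o shift x) (h *: v) - f x)) @ (0 : R)^' --> a.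
  have : a + h *: b @[h --> (0 : R)^'] --> a.
    rewrite -[X in _ --> X]addr0 -[X in _ + X](scale0r b).
    apply: cvgD; first exact: cvg_cst.
    by apply: cvgZr_tmp; exact: cvg_within.
  apply: cvg_trans; apply: near_eq_cvg; rewrite near_withinE; apply: filterE => h h0.
  rewrite /= /shift /= fE -[f x + _ + _]addrA [f x + _]addrC addrK scalerDr scalerA mulVf// scale1r.
  by rewrite scalerA expr2 mulrA mulVf// mul1r.
by split; [apply/cvg_ex; exists a|apply/cvg_lim].
Qed.

Section Chart.
Context {R : realType} {m : nat} {T : topologicalType}.
Local Notation E := 'rV[R]_m.+1.
Implicit Types c : chart R m T.

(** This set is the chart image cut by the preimage of [D] under [chart_inv], which is continuous
    within that image. *)
Lemma chart_image_open c (D : set T) : open D -> open (c @` (chart_dom c `&` D)).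
Proof.
move=> oD; rewrite (_ : _ @` _ = c @` chart_dom c `&` chart_inv c @^-1` D).
  rewrite open_setSI; last exact: chart_img_open.
  by have /continuousP := @chart_inv_continuous _ _ _ c; exact.
apply/seteqP; split=> [x [p [cp Dp] <-]|x [[p cp <-]]].
  by split; [exists p|rewrite /= chart_mapK ?inE].
by rewrite /= chart_mapK ?inE// => Dp; exists p.
Qed.

Section Diffeo.
Variables (c : chart R m T) (p q : E -> E).
Hypotheses (pK : cancel p q) (qK : cancel q p).
Hypotheses (cp : continuous p) (cq : continuous q).

Lemma diffeo_chart_image (D : set T) : (p \o c) @` D = q @^-1` (c @` D).
Proof.
apply/seteqP; split=> [x [t Dt <-]|x [t Dt tE]]; first by exists t => //=; rewrite pK.
by exists t => //=; rewrite tE qK.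
Qed.

Lemma diffeo_chart_img_open : open ((p \o c) @` chart_dom c).
Proof.
rewrite diffeo_chart_image; apply: open_comp; first by move=> x _; exact: cq.
exact: chart_img_open.
Qed.

Lemma diffeo_chart_mapK :
  {in chart_dom c, cancel (p \o c) (chart_inv c \o q)}.
Proof. by move=> t tD; rewrite /= pK chart_mapK. Qed.

Lemma diffeo_chart_map_continuous : {within chart_dom c, continuous (p \o c)}.
Proof.
apply/within_open_continuousP; first exact: chart_dom_open.
move=> t Dt; apply: continuous_comp; last exact: cp.
have := @chart_map_continuous _ _ _ c.
by move=> /(within_open_continuousP _ (@chart_dom_open _ _ _ c)); exact.
Qed.

Lemma diffeo_chart_inv_continuous :
  {within (p \o c) @` chart_dom c, continuous (chart_inv c \o q)}.
Proof.
apply/within_open_continuousP; first exact: diffeo_chart_img_open.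
move=> x; rewrite diffeo_chart_image => Dx; apply: continuous_comp; first exact: cq.
have := @chart_inv_continuous _ _ _ c.
by move=> /(within_open_continuousP _ (@chart_img_open _ _ _ c)); exact.
Qed.

(** Recoordinatization by a globally defined [p], keeping the chart domain. It serves twice: [p]
    affine normalizes the frame, [p] a [shear] reaches every symmetric matrix. *)
Definition diffeo_chart : chart R m T :=
  Chart (@chart_dom_open _ _ _ c) diffeo_chart_img_open diffeo_chart_mapK
    diffeo_chart_map_continuous diffeo_chart_inv_continuous.

End Diffeo.
End Chart.

Section Atlas.
Context {R : realType} {m : nat} (M : smoothManifold R m).
Local Notation E := 'rV[R]_m.+1.
Implicit Types c : chart R m M.

Lemma smooth_continuous (p : E -> E) : smooth_on setT p -> continuous p.
Proof. by move=> sp x; apply: differentiable_continuous; exact: (sp [::]). Qed.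

(** By maximality only the transitions to charts of the atlas have to be smooth, and these are old
    transitions composed with [q] or [p]. *)
Lemma diffeo_chart_atlas c (p q : E -> E) (pK : cancel p q) (qK : cancel q p)
    (sp : smooth_on setT p) (sq : smooth_on setT q) :
  atlas c -> atlas (diffeo_chart c pK qK (smooth_continuous sp) (smooth_continuous sq)).
Proof.
move=> Ac; apply: atlas_maximal => c' Ac'; have [s1 s2] := atlas_compatible Ac Ac'.
have oV : open (c @` (chart_dom c `&` chart_dom c')).
  exact/chart_image_open/chart_dom_open.
have oV' : open (c' @` (chart_dom c `&` chart_dom c')).
  rewrite setIC; exact/chart_image_open/chart_dom_open.
split; rewrite /transition /=.
  rewrite (diffeo_chart_image c pK qK).
  have oqV : open (q @^-1` (c @` (chart_dom c `&` chart_dom c'))).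
    apply: open_comp => // x _; exact: smooth_continuous.
  apply: (@smooth_comp _ _ _ _ q (c' \o chart_inv c) oqV _ oV _ s1) => //.
  exact: sub_smooth sq.
by apply: (@smooth_comp _ _ _ setT (c \o chart_inv c') p oV' _ openT s2 sp).
Qed.

Lemma transition_chart c c' t : chart_dom c t -> transition c c' (c t) = c' t.
Proof. by move=> ct; rewrite /transition /= chart_mapK ?inE. Qed.

Lemma in_chartE c X t : chart_dom c t -> in_chart c X (c t) = X t c.
Proof. by move=> ct; rewrite /in_chart chart_mapK ?inE. Qed.

Lemma transition_differentiable c c' x : atlas c -> atlas c' ->
  (c @` (chart_dom c `&` chart_dom c')) x -> differentiable (transition c c') x.
Proof. by move=> Ac Ac'; have [s _] := atlas_compatible Ac Ac'; exact: (s [::]). Qed.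

Lemma in_chart_transition c c' U X x : atlas c -> atlas c' -> vector_field U X ->
  (c @` (chart_dom c `&` (chart_dom c' `&` U))) x ->
  in_chart c' X (transition c c' x) = 'D_(in_chart c X x) (transition c c') x.
Proof.
move=> Ac Ac' [tX _] [t [ct [c't Ut]] <-].
rewrite transition_chart// !in_chartE// deriveE; last first.
  by apply: transition_differentiable => //; exists t.
by have [+ _] := tX t Ut; apply.
Qed.

Section Change.
Variables (c c' : chart R m M) (a : M) (U : set M) (X : 'I_m.+1 -> M -> components M).
Hypotheses (Ac : atlas c) (Ac' : atlas c').
Hypotheses (ca : chart_dom c a) (c'a : chart_dom c' a).
Hypotheses (c0 : c a = 0) (c'0 : c' a = 0).
Hypotheses (oU : open U) (Ua : U a) (vX : forall j, vector_field U (X j)).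
Local Notation phi := (transition c c').
Local Notation f j := (in_chart c (X j)).
Local Notation f' j := (in_chart c' (X j)).

(** The overlap of both chart domains with the domain of the frame, read in [c]: the transition and
    the fields in [c] are smooth there. *)
Let W := c @` (chart_dom c `&` (chart_dom c' `&` U)).

Let W0 : nbhs (0 : E) W.
Proof.
apply: open_nbhs_nbhs; split.
  by apply: chart_image_open; apply: openI => //; exact: chart_dom_open.
by exists a.
Qed.

Lemma transition_smooth : smooth_on W phi.
Proof.
have [+ _] := atlas_compatible Ac Ac'; apply: sub_smooth.
by move=> x [t [ct [c't Ut]] <-]; exists t.
Qed.

Lemma transition0 : phi 0 = 0.
Proof. by rewrite -{1}c0 transition_chart. Qed.

Lemma field_smooth j : smooth_on W (f j).
Proof.
have [_ /(_ c Ac)] := vX j; apply: sub_smooth.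
by move=> x [t [ct [c't Ut]] <-]; exists t.
Qed.

Lemma in_chart0 j : f' j 0 = 'D_(f j 0) phi 0.
Proof.
by rewrite -(in_chart_transition Ac Ac' (vX j) (nbhs_singleton W0)) transition0.
Qed.

Hypotheses (fstd : forall j, f j 0 = std j) (f'std : forall j, f' j 0 = std j).

(** The transformation law expresses [f' j \o phi] as the sum over [l] of the [l]-th component of
    [f j] times ['D_(std l) phi]. At 0 the differential of [phi] is the identity, because the frame
    is standard in both charts, so differentiating along [std k] leaves two terms. *)
Lemma derive_in_chart j k :
  'D_(std k) (f' j) 0 = 'D_(std k) (f j) 0 + 'D_(std k) ('D_(std j) phi) 0.
Proof.
have d1 l : 'D_(std l) phi 0 = std l by have := in_chart0 l; rewrite fstd f'std.
have W00 := nbhs_singleton W0.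
have dphi x : W x -> differentiable phi x by exact: (transition_smooth [::]).
have d2phi l : differentiable ('D_(std l) phi) 0 by exact: (transition_smooth [:: l]).
have df l : differentiable (f l) 0 by exact: (field_smooth l [::]).
have df' : differentiable (f' j) 0.
  have [_ /(_ c' Ac') s] := vX j; apply: (s [::]).
  by exists a.
pose g x := \sum_l f j x 0 l *: 'D_(std l) phi x.
have E1 : \forall x \near (0 : E), (f' j \o phi) x = g x.
  move: W0; apply: filterS => x Wx.
  by rewrite /= (in_chart_transition Ac Ac' (vX j) Wx) (derive_rV _ (dphi _ Wx)).
have E2 : 'D_(std k) (f' j \o phi) 0 = 'D_(std k) g 0 := near_eq_derive (std k) E1.
rewrite derive_comp ?transition0// ?d1 in E2; last exact: dphi.
apply/rowP => i; rewrite E2 [RHS]mxE.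
pose F l (x : E) := f j x 0 l * 'D_(std l) phi x 0 i.
have dF l : derivable (F l) 0 (std k).
  apply: derivableM; apply: diff_derivable.
    exact: ((differentiable_rVP _ _).1 (df j)).
  exact: ((differentiable_rVP _ _).1 (d2phi l)).
rewrite derive_coord; last first.
  apply: near_eq_derivable (E1) _; apply: diff_derivable.
  apply: differentiable_comp; first exact: dphi.
  by rewrite transition0.
rewrite (_ : (fun _ => _) = \sum_l F l) /=; last first.
  apply/funext => x; rewrite summxE fct_sumE.
  by apply: eq_bigr => l _; rewrite mxE.
rewrite derive_sum//.
under eq_bigr => l _.
  rewrite deriveM; first last.
  - by apply/diff_derivable/(differentiable_rVP _ _).1.
  - by apply/diff_derivable/(differentiable_rVP _ _).1/df.
  rewrite -!derive_coord; try exact: diff_derivable.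
  rewrite fstd d1 !stdE.
  over.
(* Only [l = i] survives in the sum with the derivative of the field, only [l = j] in the sum with
   the second derivatives of [phi]. *)
rewrite big_split /= addrC; congr (_ + _).
  rewrite (bigD1 i)//= eqxx big1 ?addr0; first by rewrite [_ *: _]mul1r.
  by move=> l li; rewrite eq_sym (negbTE li) scale0r.
rewrite (bigD1 j)//= eqxx big1 ?addr0; first by rewrite [_ *: _]mul1r.
by move=> l lj; rewrite (negbTE lj) scale0r.
Qed.

Lemma transition_derive_symmetric j k l :
  'D_(std k) ('D_(std j) phi) 0 0 l = 'D_(std j) ('D_(std k) phi) 0 0 l.
Proof.
have W00 := nbhs_singleton W0.
have dphi x : W x -> differentiable phi x by exact: (transition_smooth [::]).
have d2phi i : differentiable ('D_(std i) phi) 0 by exact: (transition_smooth [:: i]).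
(* Schwarz is applied to the [l]-th component of [phi]. Component and derivative must commute on a
   neighbourhood, since the result is differentiated again. *)
have nE i : \forall x \near (0 : E),
    ('D_(std i) phi x) 0 l = 'D_(std i) (fun x => phi x 0 l) x.
  by move: W0; apply: filterS => x Wx; rewrite (derive_coord l (diff_derivable (dphi _ Wx))).
have D i i' : 'D_(std i') ('D_(std i) phi) 0 0 l =
    'D_(std i') ('D_(std i) (fun x => phi x 0 l)) 0.
  have := derive_coord l (diff_derivable (v := std i') (d2phi i)).
  by move=> ->; exact: near_eq_derive (nE i).
have {}D := (D j k, D k j).
apply: etrans (D.1) _; apply: etrans _ (esym D.2).
apply: derive_symmetric.
- by move: W0; apply: filterS => x Wx; apply: (differentiable_rVP _ _).1; exact: dphi.
- by apply: near_eq_differentiable (nE j) _; apply: (differentiable_rVP _ _).1; exact: d2phi.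
- by apply: near_eq_differentiable (nE k) _; apply: (differentiable_rVP _ _).1; exact: d2phi.
Qed.

End Change.
End Atlas.

(** * Privileged coordinates *)

Section Bilinear.
Context {R : realType} {m : nat}.
Local Notation E := 'rV[R]_m.+1.
Implicit Types (B : 'M[R]_m) (x y z : E).

Definition hor (i : 'I_m) : 'I_m.+1 := lift ord_max i.

Lemma hor_neq i : (hor i == ord_max) = false.
Proof. by rewrite eq_sym (negbTE (neq_lift _ _)). Qed.

Lemma hor_inj : injective hor. Proof. exact: lift_inj. Qed.

Variant hor_spec : 'I_m.+1 -> Type :=
  | HorMax : hor_spec ord_max
  | Hor i : hor_spec (hor i).

Lemma horP k : hor_spec k.
Proof. by case: (unliftP ord_max k) => [i ->|->]; constructor. Qed.

(** The matrix sees horizontal coordinates only, so [std ord_max] lies in both kernels; this is what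
    makes shears invertible and brackets central. *)
Definition bil B x y : R := \sum_i \sum_k x 0 (hor i) * B i k * y 0 (hor k).

Lemma bilDl B x y z : bil B (x + y) z = bil B x z + bil B y z.
Proof.
rewrite /bil -big_split; apply: eq_bigr => i _; rewrite -big_split.
by apply: eq_bigr => k _; rewrite /= mxE !mulrDl.
Qed.

Lemma bilZl B (a : R) x z : bil B (a *: x) z = a * bil B x z.
Proof.
rewrite /bil mulr_sumr; apply: eq_bigr => i _; rewrite mulr_sumr.
by apply: eq_bigr => k _; rewrite /= mxE !mulrA.
Qed.

Lemma bilDr B x y z : bil B z (x + y) = bil B z x + bil B z y.
Proof.
rewrite /bil -big_split; apply: eq_bigr => i _; rewrite -big_split.
by apply: eq_bigr => k _; rewrite /= mxE !mulrDr.
Qed.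

Lemma bilZr B (a : R) x z : bil B z (a *: x) = a * bil B z x.
Proof.
rewrite /bil mulr_sumr; apply: eq_bigr => i _; rewrite mulr_sumr.
by apply: eq_bigr => k _; rewrite /= mxE; ring.
Qed.

Lemma bilZm (a : R) B x y : bil (a *: B) x y = a * bil B x y.
Proof.
rewrite /bil mulr_sumr; apply: eq_bigr => i _; rewrite mulr_sumr.
by apply: eq_bigr => k _; rewrite /= mxE; ring.
Qed.

Lemma bil_max_l B x : bil B (std ord_max) x = 0.
Proof.
by rewrite /bil big1// => i _; rewrite big1// => k _; rewrite stdE hor_neq !mul0r.
Qed.

Lemma bil_max_r B x : bil B x (std ord_max) = 0.
Proof.
by rewrite /bil big1// => i _; rewrite big1// => k _; rewrite stdE hor_neq mulr0.
Qed.

Lemma bil_hor_l B i x : bil B (std (hor i)) x = \sum_k B i k * x 0 (hor k).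
Proof.
rewrite /bil (bigD1 i)//= [X in _ + X]big1 ?addr0.
  by apply: eq_bigr => k _; rewrite stdE eqxx mul1r.
move=> j ji; rewrite big1// => k _.
by rewrite stdE (inj_eq hor_inj) (negbTE ji) !mul0r.
Qed.

Lemma bil_hor B i k : bil B (std (hor i)) (std (hor k)) = B i k.
Proof.
rewrite bil_hor_l (bigD1 k)//= stdE eqxx mulr1 big1 ?addr0// => j jk.
by rewrite stdE (inj_eq hor_inj) (negbTE jk) mulr0.
Qed.

Lemma Ck_bil n B : Ck n setT (fun x => bil B x x).
Proof.
apply: Ck_sum => [|i]; first exact: openT.
apply: Ck_sum => [|k]; first exact: openT.
by do 2?[apply: CkM; first exact: openT]; [exact: Ck_coord|exact: Ck_cst|exact: Ck_coord].
Qed.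

Definition shear B x : E := x + bil B x x *: std ord_max.

(** A shear leaves the horizontal coordinates alone, so the opposite quadratic term undoes it. *)
Lemma shearK B : cancel (shear B) (shear (-1 *: B)).
Proof.
move=> x; rewrite /shear !(bilDl, bilDr, bilZl, bilZr, bil_max_l, bil_max_r, bilZm).
by rewrite !mulr0 !addr0 mulN1r scaleNr addrK.
Qed.

Lemma shearNK B : cancel (shear (-1 *: B)) (shear B).
Proof.
by move=> x; have := shearK (-1 *: B) x; rewrite scalerA mulN1r opprK scale1r.
Qed.

Lemma smooth_shear B : smooth_on setT (shear B).
Proof.
apply/smooth_Ck => n; apply: CkD; first exact: openT.
  exact: (Ck_linear n setT idfun).
apply/(Ck_rV _ _ openT) => k.
rewrite (_ : (fun _ => _) = (fun x => bil B x x * (std ord_max : E) 0 k)); last first.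
  by apply/funext => x; rewrite mxE.
by apply: CkM; [exact: openT|exact: Ck_bil|exact: Ck_cst].
Qed.

Lemma derive_shear B x v :
  'D_v (shear B) x = v + (bil B v x + bil B x v) *: std ord_max.
Proof.
apply: (@derive_val _ _ _ _ _ _ _
  (@is_derive_quadratic _ _ _ _ _ _ _ (bil B v v *: std ord_max) _)).
move=> h; rewrite /shear !(bilDl, bilDr, bilZl, bilZr).
apply/rowP => k; rewrite !mxE; ring.
Qed.

Lemma derive2_shear B x v w :
  'D_w ('D_v (shear B)) x = (bil B v w + bil B w v) *: std ord_max.
Proof.
rewrite (_ : 'D_v (shear B) =
    fun x => v + (bil B v x + bil B x v) *: std ord_max); last first.
  by apply/funext => y; rewrite derive_shear.
apply: (@derive_val _ _ _ _ _ _ _ (@is_derive_quadratic _ _ _ _ _ _ _ 0 _)).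
move=> h; rewrite !(bilDl, bilDr, bilZl, bilZr).
apply/rowP => k; rewrite !mxE; ring.
Qed.

End Bilinear.

Section Affine.
Context {R : realType} {m : nat}.
Local Notation E := 'rV[R]_m.+1.

Definition affine (A : 'M[R]_m.+1) (b x : E) : E := x *m A + b.

Lemma smooth_affine A b : smooth_on setT (affine A b).
Proof.
apply/smooth_Ck => n; apply: CkD; first exact: openT.
  exact: (Ck_linear n setT (mulmxr A)).
exact: Ck_cst.
Qed.

Lemma derive_affine A b x v : 'D_v (affine A b) x = v *m A.
Proof.
apply: (@derive_val _ _ _ _ _ _ _ (@is_derive_quadratic _ _ _ _ _ _ _ 0 _)).
by move=> h; rewrite /affine mulmxDl scaler0 addr0 -scalemxAl -addrA addrC.
Qed.

End Affine.

Section Privileged.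
Context {R : realType} {m : nat} (M : heisenbergManifold R m).
Local Notation E := 'rV[R]_m.+1.
Implicit Types (X : 'I_m.+1 -> M -> components M) (c : chart R m M).

Lemma weight_gt0 (j : 'I_m.+1) : (0 < weight j)%N.
Proof. by rewrite /weight; case: ifP. Qed.

Lemma derive_coord_fun (x v : E) k : 'D_v (fun x : E => x 0 k) x = v 0 k.
Proof.
apply: (@derive_val _ _ _ _ _ _ _ (@is_derive_quadratic _ _ _ _ _ _ _ 0 _)).
by move=> h; rewrite scaler0 addr0 !mxE addrC.
Qed.

(* In step 2, once the frame is the standard one at the origin, the order
   conditions involve at most one derivative and hold automatically. *)
Lemma privileged_coordinatesP a X c :
  privileged_coordinates a X c <->
  [/\ atlas c, chart_dom c a, c a = 0 & forall j, in_chart c (X j) 0 = std j].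
Proof.
split=> [[Ac [ca c0] fs _]|[Ac ca c0 fs]]; first by [].
split=> // k; split; last first.
  exists [:: k]; first by rewrite /weight_seq big_seq1.
  by rewrite /= derive_coord_fun fs stdE eqxx oner_eq0.
case=> [|j [|j' I]]; rewrite /weight_seq ?big_cons ?big_nil.
- by rewrite /= mxE.
- rewrite addn0 /= derive_coord_fun fs stdE.
  by have [->|//] := eqVneq k j; rewrite ltnn.
(* A word of two or more letters weighs at least 2, which no [weight k] exceeds. *)
- move=> lt; suff : (weight k < weight k)%N by rewrite ltnn.
  apply: leq_trans lt; rewrite ltnS (@leq_trans 2)//.
    by rewrite /weight; case: ifP.
  by rewrite addnA (@leq_trans (weight j + weight j'))// ?leq_addr//
    (leq_add (weight_gt0 j) (weight_gt0 j')).
Qed.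

Lemma privileged_exists a U X : U a -> H_frame U X ->
  exists c, privileged_coordinates a X c.
Proof.
move=> Ua [oU vX liX _].
have [c Ac ca] := atlas_cover a.
(* The rows of [A] are the frame at [a] read in [c]. Below, [q] maps 0 to [c a] with linear part
   sending [std j] to [X j a c], so its inverse [p] standardizes the frame. *)
pose A : 'M[R]_m.+1 := \matrix_j (X j a c).
have AE (x : E) : x *m A = \sum_j x 0 j *: X j a c.
  rewrite mulmx_sum_row; apply: eq_bigr => j _; congr (_ *: _).
  by rewrite rowK.
have Au : A \in unitmx.
  rewrite -row_free_unit; apply: inj_row_free => x; rewrite AE => x0.
  apply/rowP => j; rewrite mxE.
  (* Independence concerns whole families of components: a relation in [c] reaches every other chart
     at [a] through the differential of the transition, and the remaining components are 0 by
     definition. *)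
  apply: (liX a Ua (fun j => x 0 j)); apply/funext => c'.
  rewrite fct_sumE.
  have [[Ac' c'a]|nc'] := pselect (atlas c' /\ chart_dom c' a); last first.
    rewrite big1// => i _; have [_ t2] := (vX i).1 a Ua.
    by rewrite !fctE t2// scaler0.
  rewrite [RHS](_ : _ = 'd (transition c c') (c a) (\sum_j x 0 j *: X j a c)).
    rewrite linear_sum; apply: eq_bigr => i _.
    by rewrite linearZ !fctE; have [t1 _] := (vX i).1 a Ua; rewrite (t1 c c').
  by rewrite x0 linear0.
pose p := affine (invmx A) (- (c a *m invmx A)); pose q := affine A (c a).
have pK : cancel p q.
  by move=> x; rewrite /p /q /affine mulmxDl mulNmx !mulmxKV// subrK.
have qK : cancel q p by move=> x; rewrite /p /q /affine mulmxDl mulmxK// addrK.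
have sp : smooth_on setT p := smooth_affine _ _.
have sq : smooth_on setT q := smooth_affine _ _.
have Ac' := diffeo_chart_atlas pK qK sp sq Ac.
set c' := diffeo_chart _ _ _ _ _ in Ac'.
have c'a : chart_dom c' a by [].
have c'0 : c' a = 0 by rewrite /c' /= /p /affine subrr.
exists c'; apply/privileged_coordinatesP; split=> // j.
rewrite -{1}c'0 in_chartE//; have [t1 _] := (vX j).1 a Ua.
rewrite (t1 c c')//.
have td : differentiable (transition c c') (c a).
  by apply: transition_differentiable => //; exists a.
rewrite -deriveE//.
(* [chart_inv] is arbitrary off the chart image, so the transition is known to equal [p] only near
   [c a]. *)
have : \forall x \near c a, transition c c' x = p x.
  have : nbhs (c a) (c @` chart_dom c).
    by apply: open_nbhs_nbhs; split; [exact: chart_img_open|exists a].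
  by apply: filterS => x [t ct <-]; rewrite transition_chart.
move=> /near_eq_derive ->; rewrite derive_affine.
by rewrite -[X j a c](rowK (fun j => X j a c)) rowE -mulmxA mulmxV// mulmx1.
Qed.

End Privileged.

Section FrameMatrix.
Context {R : realType} {m : nat} (M : heisenbergManifold R m).
Local Notation E := 'rV[R]_m.+1.
Variables (a : M) (U : set M) (X : 'I_m.+1 -> M -> components M).
Hypotheses (Ua : U a) (fX : H_frame U X).
Implicit Types c : chart R m M.

(** Its skew part is, up to a factor, the Levi form of [H] at [a] and is the same in all privileged
    charts; its symmetric part is what the choice of chart leaves free. *)
Definition frame_mx c : 'M[R]_m :=
  \matrix_(i, k) ('D_(std (hor k)) (in_chart c (X (hor i))) 0) 0 ord_max.

Lemma frame_mx_change c c' :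
  privileged_coordinates a X c -> privileged_coordinates a X c' ->
  exists2 Q : 'M[R]_m, Q^T = Q & frame_mx c' = frame_mx c + Q.
Proof.
move=> /privileged_coordinatesP[Ac ca c0 fs] /privileged_coordinatesP[Ac' c'a c'0 fs'].
have [oU vX _ _] := fX.
exists (\matrix_(i, k)
  ('D_(std (hor k)) ('D_(std (hor i)) (transition c c')) 0) 0 ord_max).
  apply/matrixP => i k; rewrite !mxE.
  exact: (transition_derive_symmetric Ac Ac' ca c'a c0 oU Ua).
apply/matrixP => i k; rewrite !mxE.
by rewrite (derive_in_chart Ac Ac' ca c'a c0 c'0 oU Ua vX fs fs') mxE.
Qed.

Lemma frame_mx_shear c (Q : 'M[R]_m) : privileged_coordinates a X c ->
  Q^T = Q ->
  exists2 c', privileged_coordinates a X c' & frame_mx c' = frame_mx c + Q.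
Proof.
move=> /privileged_coordinatesP[Ac ca c0 fs] QT.
have [oU vX _ _] := fX.
(* The last component of [shear S] has Hessian [S + S^T], which is [Q] because [Q] is symmetric. *)
pose S := 2^-1 *: Q.
have Ac' := diffeo_chart_atlas (shearK S) (shearNK S) (smooth_shear S)
  (smooth_shear (-1 *: S)) Ac.
set c' := diffeo_chart _ _ _ _ _ in Ac'.
have c'a : chart_dom c' a by [].
have c'0 : c' a = 0.
  rewrite /c' /= c0 /shear add0r (_ : bil S 0 0 = 0) ?scale0r//.
  by rewrite -(scale0r (0 : E)) bilZl mul0r.
have tE : \forall x \near (0 : E), transition c c' x = shear S x.
  have : nbhs (0 : E) (c @` chart_dom c).
    by apply: open_nbhs_nbhs; split; [exact: chart_img_open|exists a].
  by apply: filterS => x [t ct <-]; rewrite transition_chart.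
have fs' j : in_chart c' (X j) 0 = std j.
  rewrite (in_chart0 Ac Ac' ca c'a c0 c'0 oU Ua vX) fs.
  rewrite (near_eq_derive _ tE) derive_shear -(scale0r (0 : E)) bilZl bilZr.
  by rewrite !mul0r addr0 scale0r addr0.
exists c'; first exact/privileged_coordinatesP.
apply/matrixP => i k; rewrite !mxE.
rewrite (derive_in_chart Ac Ac' ca c'a c0 c'0 oU Ua vX fs fs') mxE; congr (_ + _).
(* A second differentiation needs the agreement near every point close to 0, which [near_join]
   provides. *)
have tE2 : \forall x \near (0 : E), 'D_(std (hor i)) (transition c c') x =
    'D_(std (hor i)) (shear S) x.
  by move: (near_join tE); apply: filterS => x; exact: near_eq_derive.
rewrite (near_eq_derive _ tE2) derive2_shear mxE stdE eqxx mulr1 !bil_hor !mxE.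
have -> : Q k i = Q i k by rewrite -{1}QT mxE.
lra.
Qed.

End FrameMatrix.

(** * Dynkin's formula in step 2 *)

Section DynkinStep2.
Context {R : realType} {L : lmodType R} (br : L -> L -> L).
Hypothesis brxx : forall x, br x x = 0.
Hypothesis brC : forall x y, br y x = - br x y.
Hypothesis br3 : forall x y z, br x (br y z) = 0.
Implicit Types x y z : L.

Lemma nested_bracket_ge3 (s : seq L) : (2 < size s)%N -> nested_bracket br s = 0.
Proof. by case: s => [|x [|y [|z s]]] //= _; rewrite br3. Qed.

(** The degree of a Dynkin term is the length of its bracket word, so from degree 3 on each word
    contains a double bracket and [br3] kills it. *)
Lemma size_word n (x y : L) (s : seq ('I_n * 'I_n)) :
  size (flatten [seq nseq pq.1 x ++ nseq pq.2 y | pq : 'I_n * 'I_n <- s]) =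
  (\sum_(pq <- s) (pq.1 + pq.2))%N.
Proof.
elim: s => [|pq s IH]; first by rewrite big_nil.
by rewrite big_cons /= size_cat IH size_cat !size_nseq.
Qed.

Lemma dynkin_term_ge3 d x y : (2 < d)%N -> dynkin_term br d x y = 0.
Proof.
move=> d2; rewrite /dynkin_term big1// => k _; rewrite big1// => s /andP[_ /eqP sd].
by rewrite nested_bracket_ge3 ?scaler0// size_word sd.
Qed.

Lemma big_tuple1 (I : finType) (P : pred (seq I)) (F : seq I -> L) :
  \sum_(s : 1.-tuple I | P s) F s = \sum_(i | P [:: i]) F [:: i].
Proof.
rewrite (reindex (fun i : I => [tuple i])) //=.
exists (fun s : 1.-tuple I => thead s) => [//|s _].
by rewrite [s]tuple_eta; apply: val_inj => /=; case: s => -[|? [|? ?]].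
Qed.

Lemma big_tuple2 (I : finType) (P : pred (seq I)) (F : seq I -> L) :
  \sum_(s : 2.-tuple I | P s) F s =
  \sum_(ij : I * I | P [:: ij.1; ij.2]) F [:: ij.1; ij.2].
Proof.
rewrite (reindex (fun ij : I * I => [tuple ij.1; ij.2])) //=.
exists (fun s : 2.-tuple I => (tnth s ord0, tnth s ord_max)) => [[i j] _ //|s _].
by apply: val_inj; case: s => -[|i [|j [|? ?]]].
Qed.

Lemma dynkin_term1 x y : dynkin_term br 1 x y = x + y.
Proof.
rewrite /dynkin_term big_nat1 expr0.
pose P (s : seq ('I_2 * 'I_2)) := all (fun pq : 'I_2 * 'I_2 => 0 < pq.1 + pq.2)%N s
   && ((\sum_(pq <- s) (pq.1 + pq.2))%N == 1%N).
pose F (s : seq ('I_2 * 'I_2)) :=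
  (1 / (1%:R * 1%:R * \prod_(pq <- s) (pq.1`! * pq.2`!)%:R) : R) *:
  nested_bracket br (flatten [seq nseq pq.1 x ++ nseq pq.2 y | pq : 'I_2 * 'I_2 <- s]).
rewrite (big_tuple1 P F).
have o1 : (1 < 2)%N by [].
pose p1 : 'I_2 * 'I_2 := (Ordinal o1, ord0); pose p2 : 'I_2 * 'I_2 := (ord0, Ordinal o1).
have PE p : P [:: p] = (p.1 + p.2 == 1)%N.
  by rewrite /P /= big_seq1 andbT; case: (p.1 + p.2)%N.
rewrite (bigD1 p1) ?PE//= (bigD1 p2) ?PE//= big1 ?addr0; last first.
  by move=> [[[|[|//]] ?] [[|[|//]] ?]]; rewrite PE.
by rewrite /F !big_seq1 /= !mulr1 divr1 !scale1r.
Qed.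

(** For [k = 1] only the pair (1, 1) matters, with coefficient 1/2. For [k = 2] the words [xy] and
    [yx] carry the same coefficient and cancel by skewness. All other words are [xx] or [yy]. *)
Lemma dynkin_term2 x y : dynkin_term br 2 x y = 2^-1 *: br x y.
Proof.
rewrite /dynkin_term big_nat_recr//= big_nat1 expr0 expr1.
pose P (s : seq ('I_3 * 'I_3)) := all (fun pq : 'I_3 * 'I_3 => 0 < pq.1 + pq.2)%N s
   && ((\sum_(pq <- s) (pq.1 + pq.2))%N == 2%N).
pose F (e : R) (k : nat) (s : seq ('I_3 * 'I_3)) :=
  (e / (k%:R * 2%:R * \prod_(pq <- s) (pq.1`! * pq.2`!)%:R) : R) *:
  nested_bracket br (flatten [seq nseq pq.1 x ++ nseq pq.2 y | pq : 'I_3 * 'I_3 <- s]).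
rewrite (big_tuple1 P (F 1 1%N)) (big_tuple2 P (F (-1) 2%N)).
have o1 : (1 < 3)%N by [].
pose p10 : 'I_3 * 'I_3 := (Ordinal o1, ord0); pose p01 : 'I_3 * 'I_3 := (ord0, Ordinal o1).
pose p11 : 'I_3 * 'I_3 := (Ordinal o1, Ordinal o1).
have P1 p : P [:: p] = (p.1 + p.2 == 2)%N.
  by rewrite /P /= big_seq1 andbT; case: (p.1 + p.2)%N.
have P2 p q : P [:: p; q] = [&& 0 < p.1 + p.2, 0 < q.1 + q.2 & (p.1 + p.2) + (q.1 + q.2) == 2]%N.
  by rewrite /P /= big_cons big_seq1 andbT andbA.
rewrite (bigD1 p11) ?P1//= big1 ?addr0; last first.
  move=> [i j]; rewrite P1 /= => /andP[ij nij].
  rewrite /F; set w := flatten _.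
  have [->|->] : w = [:: x; x] \/ w = [:: y; y].
    move: ij nij; rewrite /w {w} /=.
    by case: i j => [[|[|[|//]]] ?] [[|[|[|//]]] ?] //= _ _; [right|left].
  - by rewrite /= brxx scaler0.
  - by rewrite /= brxx scaler0.
rewrite (bigD1 (p10, p01)) ?P2//= (bigD1 (p01, p10)) ?P2//= big1; last first.
  move=> [[i j] [k l]]; rewrite P2 /= => H.
  rewrite /F; set w := flatten _.
  have [->|->] : w = [:: x; x] \/ w = [:: y; y].
    move: H; rewrite /w {w} /=.
    by case: i j k l => [[|[|[|//]]] ?] [[|[|[|//]]] ?] [[|[|[|//]]] ?] [[|[|[|//]]] ?] //= _;
      do ?[by left]; right.
  - by rewrite /= brxx scaler0.
  - by rewrite /= brxx scaler0.
rewrite /F !big_seq1 !big_cons !big_nil /= (brC x y) addr0 scalerN subrr addr0.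
by congr (_ *: _); rewrite !mulr1 !mul1r.
Qed.

Lemma is_dynkin_productP x y z :
  is_dynkin_product br x y z <-> z = x + y + 2^-1 *: br x y.
Proof.
have S N : (1 < N)%N ->
    \sum_(1 <= d < N.+1) dynkin_term br d x y = x + y + 2^-1 *: br x y.
  move=> N1; rewrite (@big_cat_nat _ _ _ 3)//=.
  rewrite big_nat_recr//= big_nat1 dynkin_term1 dynkin_term2 big_nat big1 ?addr0//.
  by move=> d /andP[d3 _]; exact: dynkin_term_ge3.
split=> [[N _ NP]|->].
  by have /= := NP (maxn N 2) (leq_maxl _ _); rewrite S// leq_max orbT.
by exists 2%N => // N /= N2; rewrite S.
Qed.

End DynkinStep2.

Section DynkinMorph.
Context {R : realType} {L L' : lmodType R} (br : L -> L -> L) (br' : L' -> L' -> L').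
Variable f : {linear L -> L'}.
Hypothesis fbr : forall x y, f (br x y) = br' (f x) (f y).

Lemma nested_bracket_morph s :
  f (nested_bracket br s) = nested_bracket br' (map f s).
Proof.
elim: s => [|x [|y s] IH] /=; [exact: linear0|by []|by rewrite fbr IH].
Qed.

Lemma dynkin_term_morph d x y :
  f (dynkin_term br d x y) = dynkin_term br' d (f x) (f y).
Proof.
rewrite linear_sum; apply: eq_bigr => k _; rewrite linear_sum.
apply: eq_bigr => s _; rewrite linearZ nested_bracket_morph; congr (_ *: nested_bracket _ _).
rewrite map_flatten -map_comp; congr flatten; apply: eq_map => pq /=.
by rewrite map_cat !map_nseq.
Qed.

(** Partial sums in [L'] are images of partial sums in [L]; injectivity makes the latter stationary
    as soon as the former are. *)
Lemma is_dynkin_product_morph x y w : injective f ->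
  is_dynkin_product br' (f x) (f y) w <->
  exists2 z, is_dynkin_product br x y z & w = f z.
Proof.
move=> fI; split=> [[N _ NP]|[z [N _ NP] ->]]; last first.
  exists N => // n /= Nn; rewrite (NP n Nn) linear_sum.
  by apply: eq_bigr => d _; rewrite dynkin_term_morph.
have wE n : (N <= n)%N -> w = f (\sum_(1 <= d < n.+1) dynkin_term br d x y).
  move=> Nn; rewrite (NP n Nn) linear_sum.
  by apply: eq_bigr => d _; rewrite dynkin_term_morph.
exists (\sum_(1 <= d < N.+1) dynkin_term br d x y); last exact: wE.
by exists N => // n /= Nn; apply: fI; rewrite -!wE.
Qed.

End DynkinMorph.

(** * The model group *)

Section Model.
Context {R : realType} {m : nat}.
Local Notation E := 'rV[R]_m.+1.
Local Notation e := (std ord_max : E).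
Implicit Types (B : 'M[R]_m) (x y xi eta : E).

(* [\sum_j xi_j X_j^(a)], for the limit fields [X_j^(a) = model_field B (std j)]. *)
Definition model_field B xi : E -> E := fun x => xi + bil B xi x *: e.

Lemma model_field_is_linear B : linear (model_field B).
Proof.
move=> a x y; apply/funext => z.
rewrite /model_field !fctE bilDl bilZl scalerDl scalerDr scalerA.
by rewrite -!addrA; congr (_ + _); rewrite addrCA.
Qed.

HB.instance Definition _ B :=
  GRing.isLinear.Build R E (E -> E) *:%R (model_field B) (model_field_is_linear B).

Lemma model_field0 B xi : model_field B xi 0 = xi.
Proof. by rewrite /model_field -(scale0r (0 : E)) bilZr mul0r scale0r addr0. Qed.

Lemma model_field_inj B : injective (model_field B).
Proof. by move=> x y /(congr1 (fun f => f 0)); rewrite !model_field0. Qed.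

Lemma lin_span_model_field B (u : E -> E) :
  lin_span (fun j => model_field B (std j)) u <-> exists xi, u = model_field B xi.
Proof.
have sE (x : 'I_m.+1 -> R) : \sum_j x j *: model_field B (std j) =
    model_field B (\sum_j x j *: std j).
  by rewrite linear_sum; apply: eq_bigr => j _; rewrite linearZ.
split=> [[x ->]|[xi ->]]; first by rewrite sE; eexists.
by exists (fun j => xi 0 j); rewrite sE -rV_sum_std.
Qed.

(** The bracket of model fields on coefficient vectors, with the sign of [field_bracket]. Its values
    are multiples of [e], hence central. *)
Definition model_bracket B xi eta : E := (bil B eta xi - bil B xi eta) *: e.

Lemma derive_model_field B xi x v : 'D_v (model_field B xi) x = bil B xi v *: e.
Proof.
apply: (@derive_val _ _ _ _ _ _ _ (@is_derive_quadratic _ _ _ _ _ _ _ 0 _)).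
move=> h; rewrite /model_field bilDr bilZr scaler0 addr0 scalerDl scalerA.
by rewrite addrA addrAC.
Qed.

Lemma model_field_bracket B xi eta :
  model_field B (model_bracket B xi eta) =
  field_bracket (model_field B xi) (model_field B eta).
Proof.
apply/funext => x; rewrite /field_bracket !derive_model_field.
rewrite /model_bracket /model_field !(bilZl, bilDr, bilZr, bil_max_l, bil_max_r).
by rewrite !mulr0 scale0r !addr0 scalerBl.
Qed.

Lemma is_dynkin_product_model B xi eta w :
  is_dynkin_product field_bracket (model_field B xi) (model_field B eta) w <->
  w = model_field B (xi + eta + 2^-1 *: model_bracket B xi eta).
Proof.
rewrite (is_dynkin_product_morph (model_field_bracket B) _ _ _ (@model_field_inj B)).
have H := @is_dynkin_productP R E (model_bracket B).
have brxx x : model_bracket B x x = 0 by rewrite /model_bracket subrr scale0r.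
have brC x y : model_bracket B y x = - model_bracket B x y.
  by rewrite /model_bracket -scaleNr opprB.
have br3 x y z : model_bracket B x (model_bracket B y z) = 0.
  by rewrite /model_bracket bilZl bilZr bil_max_l bil_max_r !mulr0 subrr scale0r.
split=> [[z /(H brxx brC br3) -> //]|->].
by eexists; first exact/(H brxx brC br3).
Qed.

Lemma is_derive_coord (g : R -> E) (t : R) (v : E) k :
  is_derive t (1 : R) g v -> is_derive t (1 : R) (fun s => g s 0 k) (v 0 k).
Proof.
move=> [dg <-]; split; first by have /derivable_mxP := dg; apply.
by rewrite -derive_coord.
Qed.

(** Uniqueness of the flow of a model field comes from this: horizontal coordinates have constant
    speed, so the speed of the last one is affine in time, and a function with zero derivative is
    constant. *)
Lemma quadratic_primitive (f : R -> R) (p q : R) : f 0 = 0 ->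
  (forall t : R, is_derive t (1 : R) f (p + t * q)) ->
  forall t, f t = t * p + t ^+ 2 * (2^-1 * q).
Proof.
move=> f0 df t.
pose g (s : R) := s * p + s ^+ 2 * (2^-1 * q).
have dg s : is_derive s (1 : R) g (p + s * q).
  apply: (@is_derive_quadratic _ _ _ _ _ _ _ (2^-1 * q)) => h.
  rewrite /g /GRing.scale /=; field => //.
have dfg u : is_derive u (1 : R) (f - g) 0.
  by apply: is_derive_eq (is_deriveB (df u) (dg u)) _; rewrite subrr.
have E0 : (f - g) t = (f - g) 0 by apply: is_derive_0_is_cst.
move: E0; rewrite !fctE f0 /g expr0n /= !mul0r addr0 subr0 => /eqP.
by rewrite subr_eq0 => /eqP.
Qed.

Lemma bil_hor_scale B xi x y (t : R) :
  (forall i, x 0 (hor i) = t * y 0 (hor i)) -> bil B xi x = t * bil B xi y.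
Proof.
move=> xy; rewrite /bil mulr_sumr; apply: eq_bigr => i _; rewrite mulr_sumr.
by apply: eq_bigr => k _; rewrite xy; ring.
Qed.

Lemma is_exp_model_field B xi y :
  is_exp (model_field B xi) y <-> y = xi + (2^-1 * bil B xi xi) *: e.
Proof.
split=> [[g [g0 dg <-]]|->].
  have gh t i : g t 0 (hor i) = t * xi 0 (hor i).
    have := @quadratic_primitive (fun s => g s 0 (hor i)) (xi 0 (hor i)) 0.
    rewrite g0 mxE => /(_ erefl) H.
    apply: etrans (H _ t) _; last by rewrite !mulr0 addr0.
    move=> s; rewrite mulr0 addr0; have := is_derive_coord (hor i) (dg s).
      by rewrite /model_field mxE [X in _ + X]mxE stdE hor_neq mulr0 addr0.
  have gm t : g t 0 ord_max =
      t * xi 0 ord_max + t ^+ 2 * (2^-1 * bil B xi xi).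
    apply: (@quadratic_primitive (fun s => g s 0 ord_max)); first by rewrite g0 mxE.
    move=> s; have := is_derive_coord ord_max (dg s).
    rewrite /model_field mxE [X in _ + X]mxE stdE eqxx mulr1.
    by rewrite (bil_hor_scale B xi (gh s)).
  apply/rowP => k; rewrite mxE [X in _ + X]mxE stdE.
  case: (horP k) => [|i]; first by rewrite gm eqxx !mulr1 expr1n !mul1r.
  by rewrite gh hor_neq mulr0 addr0 mul1r.
exists (fun t => t *: xi + (t ^+ 2 * (2^-1 * bil B xi xi)) *: e); split.
- by rewrite expr0n mul0r !scale0r addr0.
- move=> t; rewrite /model_field bilDr !bilZr bil_max_r mulr0 addr0.
  apply: (@is_derive_quadratic _ _ _ _ _ _ _ ((2^-1 * bil B xi xi) *: e)) => h.
  apply/rowP => k; rewrite !mxE /GRing.scale /=; field => //.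
- by rewrite scale1r expr1n mul1r.
Qed.

(** [y] comes first in [bil]: the derivative of [y |-> x . y] at 0 along [xi] is
    [model_field B xi x], so the model fields are the left-invariant ones. *)
Definition model_mul B x y : E := x + y + bil B y x *: e.

(** The last coordinate of the product of [std (hor k)] and [std (hor i)] is [B i k]. *)
Lemma model_mul_inj B B' : model_mul B = model_mul B' -> B = B'.
Proof.
move=> BB'; apply/matrixP => i k.
have E0 C : model_mul C (std (hor k)) (std (hor i)) 0 ord_max = C i k.
  by rewrite /model_mul bil_hor !mxE !eqxx eq_sym hor_neq eq_sym hor_neq mulr1 !add0r.
by rewrite -E0 BB' E0.
Qed.

Lemma model_mulP B x y z :
  model_mul B x y = z <->
  exists u v w : E -> E,
    [/\ lin_span (fun j => model_field B (std j)) u,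
        lin_span (fun j => model_field B (std j)) v,
        lin_span (fun j => model_field B (std j)) w &
        [/\ is_exp u x, is_exp v y, is_dynkin_product field_bracket u v w &
            is_exp w z]].
Proof.
(* Half the bracket cancels the term [1/2 bil B xi eta] of the exponential of the sum and doubles
   [1/2 bil B eta xi], leaving a single unsymmetrized term. *)
have mulE xi eta : xi + eta + 2^-1 *: model_bracket B xi eta +
      (2^-1 * bil B (xi + eta + 2^-1 *: model_bracket B xi eta)
                 (xi + eta + 2^-1 *: model_bracket B xi eta)) *: e =
    model_mul B (xi + (2^-1 * bil B xi xi) *: e) (eta + (2^-1 * bil B eta eta) *: e).
  rewrite /model_mul /model_bracket.
  rewrite !(bilDl, bilDr, bilZl, bilZr, bil_max_l, bil_max_r).
  by apply/rowP => k; rewrite !mxE; field => //.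
split=> [<-|[u [v [w [/lin_span_model_field[xi ->] /lin_span_model_field[eta ->] _]]]]].
  pose xi := x - (2^-1 * bil B x x) *: e; pose eta := y - (2^-1 * bil B y y) *: e.
  (* The logarithm subtracts what [is_exp_model_field] adds; [bil] does not see the correction along
     [e]. *)
  have xE t : t = (t - (2^-1 * bil B t t) *: e) +
     (2^-1 * bil B (t - (2^-1 * bil B t t) *: e) (t - (2^-1 * bil B t t) *: e)) *: e.
    rewrite -scaleNr !(bilDl, bilDr, bilZl, bilZr, bil_max_l, bil_max_r).
    by apply/rowP => k; rewrite !mxE; ring.
  exists (model_field B xi), (model_field B eta),
    (model_field B (xi + eta + 2^-1 *: model_bracket B xi eta)).
  split; try by apply/lin_span_model_field; eexists.
  split.
  - exact/is_exp_model_field/xE.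
  - exact/is_exp_model_field/xE.
  - exact/is_dynkin_product_model.
  - by apply/is_exp_model_field; rewrite mulE -!xE.
by move=> [/is_exp_model_field -> /is_exp_model_field -> /is_dynkin_product_model ->
  /is_exp_model_field ->]; rewrite mulE.
Qed.

End Model.

(** * Convergence of the rescaled fields *)

Section Rescaling.
Context {R : realType} {m : nat}.
Local Notation E := 'rV[R]_m.+1.
Local Notation e := (std ord_max : E).

Lemma compact_cvgP (F : R -> E -> E) (G : E -> E) :
  {family compact, F @ (0 : R)^' --> G} <->
  forall K : set E, compact K -> forall d : R, 0 < d ->
    \forall t \near (0 : R)^', forall x, K x -> `|G x - F t x| < d.
Proof.
split=> [/fam_cvgP H K cK d d0|H].
  apply: (H K cK [set g | forall x, K x -> `|G x - g x| < d]).
  apply/uniform_nbhs.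
  exists [set xy : E * E | ball xy.1 d xy.2]; split.
    by rewrite -entourage_ballE; exists d.
  by move=> h /= hK x Kx; have := hK x Kx; rewrite -ball_normE.
apply/fam_cvgP => K cK P /uniform_nbhs[A [+ sub]].
rewrite -entourage_ballE => -[d /= d0 dA].
have := H K cK d d0; apply: filterS => t Ht; apply: sub => x Kx.
by apply: dA => /=; rewrite -ball_normE; exact: Ht.
Qed.

Lemma coord_norm_le (x : E) k : `|x 0 k| <= `|x|.
Proof.
by rewrite [leRHS]/Num.norm /= mx_normrE; exact: (le_bigmax _ _ (ord0, k)).
Qed.

Lemma norm_lt_coord (x : E) d : 0 < d -> (forall k, `|x 0 k| < d) -> `|x| < d.
Proof.
move=> d0 H; rewrite [ltLHS]/Num.norm /= mx_normrE.
by rewrite bigmax_lt// => -[i k] _ /=; rewrite ord1; exact: H.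
Qed.

Lemma norm_le_coord (x : E) d : 0 <= d -> (forall k, `|x 0 k| <= d) -> `|x| <= d.
Proof.
move=> d0 H; rewrite [leLHS]/Num.norm /= mx_normrE.
by rewrite bigmax_le// => -[i k] _ /=; rewrite ord1; exact: H.
Qed.

Lemma dilation_is_linear (t : R) : linear (@dilation R m t).
Proof. by move=> a x y; apply/rowP => k; rewrite !mxE; ring. Qed.

HB.instance Definition _ (t : R) :=
  GRing.isLinear.Build R E E *:%R (@dilation R m t) (dilation_is_linear t).

Lemma dilation_std (t : R) i : dilation t (std i) = t ^+ weight i *: (std i : E).
Proof.
apply/rowP => k; rewrite !mxE; have [->//|ki] := eqVneq k i.
by rewrite eqxx !mulr0.
Qed.

Lemma dilation_norm (t : R) (x : E) : `|t| <= 1 -> `|dilation t x| <= `|t| * `|x|.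
Proof.
move=> t1; apply: norm_le_coord; first exact: mulr_ge0.
move=> k; rewrite mxE normrM normrX ler_pM// ?exprn_ge0// ?coord_norm_le//.
by case: (weight k) (weight_gt0 k) => // w _; rewrite exprS ler_piMr// exprn_ile1.
Qed.

Lemma compact_norm_bound (K : set E) : compact K ->
  exists2 C : R, 0 < C & forall x, K x -> `|x| <= C.
Proof.
move=> /compact_bounded[C [_ CK]]; exists (`|C| + 1); first by rewrite ltr_wpDl.
move=> x Kx; apply: CK => //; apply: le_lt_trans (ler_norm _) _.
by rewrite ltrDl.
Qed.

Lemma near0_norm_lt (d : R) : 0 < d ->
  \forall t \near (0 : R)^', t != 0 /\ `|t| < d.
Proof.
move=> d0; rewrite near_withinE; exists d => //= t.
by rewrite /= sub0r normrN => td t0; split.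
Qed.

(** This lets globally defined limits be computed from a field known only near 0. *)
Lemma dilation_small (K W : set E) : compact K -> nbhs (0 : E) W ->
  \forall t \near (0 : R)^', forall x, K x -> W (dilation t x).
Proof.
move=> cK /nbhs_ballP[r /= r0 rW]; have [C C0 KC] := compact_norm_bound cK.
have d0 : 0 < Num.min 1 (r / C) by rewrite lt_min ltr01 divr_gt0.
apply: filterS (near0_norm_lt d0) => t [_ +] x Kx.
rewrite lt_min ltr_pdivlMr// => /andP[t1 tr]; apply: rW.
rewrite -ball_normE /= sub0r normrN; apply: le_lt_trans tr.
apply: le_trans (dilation_norm _ (ltW t1)) _.
by rewrite ler_wpM2l// KC.
Qed.

Section Limits.
Variables (K : set E) (h : E -> R).
Hypotheses (cK : compact K) (dh : differentiable h 0).
Variable d : R.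
Hypothesis d0 : 0 < d.

(** First of three regimes for [t] to a power times [h (dilation t x)]: exponent 0 here, then
    positive, then -1. *)
Lemma dilation_cvg :
  \forall t \near (0 : R)^', forall x, K x -> `|h 0 - h (dilation t x)| < d.
Proof.
apply: (@dilation_small K [set y | `|h 0 - h y| < d]) => //.
by have /cvgrPdist_lt := differentiable_continuous dh; apply.
Qed.

Lemma dilation_cvg_pos p : (0 < p)%N ->
  \forall t \near (0 : R)^', forall x, K x -> `|t ^+ p * h (dilation t x)| < d.
Proof.
move=> p0; pose C := `|h 0| + 1.
have C0 : 0 < C by rewrite ltr_wpDl.
have bd : \forall t \near (0 : R)^', forall x, K x -> `|h (dilation t x)| < C.
  apply: (@dilation_small K [set y | `|h y| < C]) => //.
  have /cvgrPdist_lt /(_ 1 ltr01) := differentiable_continuous dh.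
  apply: filterS => x; rewrite distrC => H.
  by rewrite /= /C -ltrBlDl (le_lt_trans _ H)// lerB_dist.
have m0 : 0 < Num.min 1 (d / C) by rewrite lt_min ltr01 divr_gt0.
apply: filterS2 bd (near0_norm_lt m0) => t bt [_ +] x Kx.
rewrite lt_min ltr_pdivlMr// => /andP[t1 td].
rewrite normrM normrX; apply: le_lt_trans td.
rewrite ler_pM// ?exprn_ge0//; last exact/ltW/bt.
by case: p p0 => // p _; rewrite exprS ler_piMr// exprn_ile1// ltW.
Qed.

(** First-order expansion of [h] at 0. The coordinate [x 0 ord_max] is scaled by [t ^+ 2], so its
    contribution vanishes after division by [t] and only horizontal derivatives remain. *)
Lemma dilation_cvg_derive : h 0 = 0 ->
  \forall t \near (0 : R)^', forall x, K x ->
    `|\sum_k x 0 (hor k) * 'D_(std (hor k)) h 0 - t^-1 * h (dilation t x)| < d.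
Proof.
move=> h0; have [C C0 KC] := compact_norm_bound cK.
have d20 : 0 < d / 2 / C by rewrite !divr_gt0.
pose D := `|'D_e h 0| + 1.
have D0 : 0 < D by rewrite ltr_wpDl.
have H1 := dilation_small cK (differentiable_le dh d20 : nbhs (0 : E) [set k | _]).
have m0 : 0 < Num.min 1 (d / 2 / C / D) by rewrite lt_min ltr01 !divr_gt0.
apply: filterS2 H1 (near0_norm_lt m0) => t Ht [t0 +] x Kx.
rewrite lt_min ltr_pdivlMr// => /andP[t1 td].
have {Ht} /= := Ht x Kx; rewrite add0r h0 subr0.
have -> : 'd h 0 (dilation t x) =
    t * \sum_k x 0 (hor k) * 'D_(std (hor k)) h 0 + t ^+ 2 * (x 0 ord_max * 'D_e h 0).
  rewrite -deriveE// derive_rV// big_ord_recr /= mulr_sumr; congr (_ + _).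
    apply: eq_bigr => k _; rewrite (_ : widen_ord _ _ = hor k).
      by rewrite mxE /weight hor_neq expr1 [RHS]mulrA.
    by apply: val_inj; rewrite [RHS]lift_max.
  by rewrite mxE /weight eqxx [RHS]mulrA.
set S := \sum_k _; set h' := h _ => Hh.
(* Half of [d] pays for the expansion remainder divided by [t], half for the vertical term, which is
   still of order [t]. *)
have -> : S - t^-1 * h' =
    - t^-1 * (h' - (t * S + t ^+ 2 * (x 0 ord_max * 'D_e h 0))) -
    t * (x 0 ord_max * 'D_e h 0).
  by field.
apply: le_lt_trans (ler_normB _ _) _; rewrite (splitr d).
apply: ler_ltD.
  rewrite normrM normrN normfV ler_pdivrMl ?normr_gt0//.
  apply: le_trans Hh _; rewrite mulrC.
  apply: le_trans (ler_wpM2r (ltW d20) (dilation_norm x (ltW t1))) _.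
  rewrite -[leLHS]mulrA ler_wpM2l// mulrC -[leLHS]mulrA ler_piMr//.
    by rewrite ltW// divr_gt0.
  by rewrite ler_pdivrMl// mulr1 KC.
rewrite !normrM.
have xC : `|x 0 ord_max| <= C by rewrite (le_trans (coord_norm_le _ _))// KC.
have DD : `|'D_e h 0| <= D by rewrite /D lerDl.
apply: le_lt_trans (_ : `|t| * (C * D) < _).
  by rewrite ler_wpM2l// ler_pM.
by move: td; rewrite ltr_pdivlMr// mulrAC mulrA.
Qed.

End Limits.

(** Each derivative along [std i] passes through [dilation t] and releases a factor
    [t ^+ weight i]. *)
Lemma partials_rescaled (V : set E) (f : E -> E) j I (t : R) x :
  open V -> smooth_on V f -> t != 0 -> V (dilation t x) ->
  partials I (rescaled j f t) x =
    t ^+ (weight j + weight_seq I) *: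
      dilation t^-1 (partials I f (dilation t x)).
Proof.
move=> oV sf t0; elim: I x => [|i I IH] x Vx.
  by rewrite /weight_seq big_nil addn0.
have oV' : open (dilation t @^-1` V).
  by apply: open_comp => // y _; exact: linear_rV_continuous.
have nE : \forall y \near x, partials I (rescaled j f t) y =
    t ^+ (weight j + weight_seq I) *:
      dilation t^-1 (partials I f (dilation t y)).
  by apply: filterS (open_nbhs_nbhs (conj oV' Vx)) => y; exact: IH.
have dp : differentiable (partials I f) (dilation t x) by exact: sf.
have dd : differentiable (dilation t : E -> E) x by exact: linear_rV_differentiable.
have dc : differentiable (partials I f \o dilation t) x by exact: differentiable_comp.
pose L : {linear E -> E} := (t ^+ (weight j + weight_seq I) \*: dilation t^-1)%R.
have dL : differentiable L (partials I f (dilation t x)).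
  exact: linear_rV_differentiable.
rewrite /= (near_eq_derive _ nE).
rewrite -[LHS]/('D_(std i) (L \o (partials I f \o dilation t)) x).
rewrite (derive_comp (std i) dc dL) (derive_comp (std i) dd dp).
have Dd : 'D_(std i) (dilation t : E -> E) x = t ^+ weight i *: std i.
  by rewrite derive_linear_rV /= dilation_std.
rewrite Dd derive_linear_rV deriveE// linearZ /= -deriveE//.
rewrite linearZ scalerA -exprD -addnA; congr (_ ^+ (_ + _) *: _).
by rewrite /weight_seq big_cons addnC.
Qed.

End Rescaling.

Section ModelLimit.
Context {R : realType} {m : nat}.
Local Notation E := 'rV[R]_m.+1.
Local Notation e := (std ord_max : E).

Lemma weight_max : @weight m ord_max = 2%N.
Proof. by rewrite /weight eqxx. Qed.

Lemma weight_hor i : @weight m (hor i) = 1%N.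
Proof. by rewrite /weight hor_neq. Qed.

Lemma partials_cst (W : normedModType R) (I : seq 'I_m.+1) (w : W) :
  I != [::] -> partials I (cst w : E -> W) = cst 0.
Proof.
elim: I => [//|i [|i' I] IH] _; apply/funext => x; first exact: derive_cst.
rewrite -[LHS]/('D_(std i) (partials (i' :: I) (cst w)) x) IH//; exact: derive_cst.
Qed.

Lemma partials_model_field (B : 'M[R]_m) xi I (x : E) :
  partials I (model_field B xi) x =
  match I with
  | [::] => xi + bil B xi x *: e
  | [:: i] => bil B xi (std i) *: e
  | _ => 0
  end.
Proof.
case/lastP: I => [//|I i].
rewrite /partials foldr_rcons (_ : 'D_(std i) _ = cst (bil B xi (std i) *: e)); last first.
  by apply/funext => y; rewrite derive_model_field.
case: I => [//|i' I]; rewrite -/(partials _ _) partials_cst//=.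
by case: I.
Qed.

Lemma smooth_model_field (B : 'M[R]_m) xi : smooth_on setT (model_field B xi).
Proof.
case=> [|i I] x _; last first.
  rewrite (_ : partials _ _ = cst (partials (i :: I) (model_field B xi) 0)).
    exact: differentiable_cst.
  by apply/funext => y; rewrite /cst !partials_model_field; case: I.
have bl : linear (fun y : E => bil B xi y *: e).
  by move=> a y z; rewrite bilDr bilZr scalerDl scalerA.
pose blM := GRing.isLinear.Build _ _ _ _ _ bl.
pose bL : {linear E -> E} := HB.pack (fun y : E => bil B xi y *: e) blM.
have pE : partials [::] (model_field B xi) = (fun=> xi) + (bL : E -> E).
  by apply/funext => y; rewrite partials_model_field.
rewrite pE; apply: differentiableD; first exact: differentiable_cst.
exact: linear_rV_differentiable.
Qed.

(** Component [k] of a rescaled derivative is [h k (dilation t x)] times [t] to the power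
    [s - weight k], and the sign of this exponent decides the limit: 0, the value at 0, or a first
    derivative. *)
Lemma is_rescaling_limit_model (V : set E) (f : E -> E) j (B : 'M[R]_m) :
  open V -> V 0 -> smooth_on V f -> f 0 = std j ->
  (forall k, j != ord_max ->
     ('D_(std (hor k)) f 0) 0 ord_max = bil B (std j) (std (hor k))) ->
  is_rescaling_limit j f (model_field B (std j)).
Proof.
move=> oV V0 sf f0 df; split; first exact: smooth_model_field.
move=> I; apply/compact_cvgP => K cK d d0.
pose s := (weight j + weight_seq I)%N.
pose h k (y : E) := partials I f y 0 k.
have dh k : differentiable (h k) 0.
  by apply: (differentiable_rVP _ _).1; exact: sf.
have sc : \forall t \near (0 : R)^', forall x, K x -> forall k,
    partials I (rescaled j f t) x 0 k =
      t ^+ s * (t^-1 ^+ weight k * h k (dilation t x)).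
  have nV : nbhs (0 : E) V by exact: open_nbhs_nbhs.
  apply: filterS2 (dilation_small cK nV) (near0_norm_lt ltr01) => t Vt [t0 _] x Kx k.
  by rewrite (partials_rescaled _ _ oV sf t0 (Vt x Kx)) !mxE.
suff H k : \forall t \near (0 : R)^', forall x, K x ->
    `|partials I (model_field B (std j)) x 0 k -
      t ^+ s * (t^-1 ^+ weight k * h k (dilation t x))| < d.
  have {}H : \forall t \near (0 : R)^', forall k x, K x ->
    `|partials I (model_field B (std j)) x 0 k -
      t ^+ s * (t^-1 ^+ weight k * h k (dilation t x))| < d.
    by apply: filter_forall.
  apply: filterS2 sc H => t St Ht x Kx; apply: norm_lt_coord => // k.
  by rewrite !mxE St//; exact: Ht.
have t_neq0 := near0_norm_lt (@ltr01 R).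
have [ks|sk|ks] := ltngtP (weight k) s.
- have Q0 x : partials I (model_field B (std j)) x 0 k = 0.
    rewrite partials_model_field; move: ks; rewrite /s /weight_seq.
    case: I {s h dh sc} => [|i [|i' I]]; rewrite ?big_cons ?big_nil ?addn0 ?mxE//.
      case: (horP j) => [|j']; case: (horP k) => [|k'];
        rewrite ?weight_max ?weight_hor// => _.
      by rewrite /= hor_neq bil_max_l mul0r addr0.
    case: (horP k) => [|k']; last by rewrite /= hor_neq mulr0.
    case: (horP j) => [|j']; case: (horP i) => [|i'];
        rewrite ?weight_max ?weight_hor// => _;
        by rewrite ?bil_max_l ?bil_max_r mul0r.
  have p0 : (0 < s - weight k)%N by rewrite subn_gt0.
  apply: filterS2 t_neq0 (dilation_cvg_pos cK (dh k) d0 p0) => t [t0 _] Ht x Kx.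
  rewrite Q0 sub0r normrN mulrA exprVn -expfB//; exact: Ht.
(* A negative exponent forces [s = 1] and weight 2: no derivative taken, [j] horizontal, last
   component. *)
- have I0 : I = [::].
    move: sk; rewrite /s /weight_seq; case: (I) => [//|i I'].
    rewrite big_cons ltnNge => /negP[]; apply: (@leq_trans (1 + (1 + 0))).
      by rewrite /weight; case: ifP.
    by rewrite !leq_add// weight_gt0.
  subst I; move: sk; rewrite /s /weight_seq big_nil addn0 => {s sc} jk.
  have kmax : k = ord_max.
    by move: jk; case: (horP k) => // k'; case: (horP j) => [|j'];
      rewrite ?weight_max ?weight_hor.
  subst k; case: (horP j) f0 df jk => [|j'] f0 df; first by rewrite ltnn.
  move=> _; rewrite weight_max weight_hor.
  have h0 : h ord_max 0 = 0 by rewrite /h /= f0 stdE eq_sym hor_neq.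
  have := dilation_cvg_derive cK (dh ord_max) d0 h0.
  apply: filterS2 t_neq0 => t [t0 _] Ht x Kx.
  have -> : partials [::] (model_field B (std (hor j'))) x 0 ord_max =
      \sum_k0 x 0 (hor k0) * 'D_(std (hor k0)) (h ord_max) 0.
    rewrite partials_model_field mxE stdE eq_sym hor_neq add0r mxE stdE eqxx mulr1.
    rewrite bil_hor_l; apply: eq_bigr => l _; rewrite mulrC; congr (_ * _).
    rewrite -bil_hor -df ?hor_neq// derive_coord//.
    by apply: diff_derivable; exact: (sf [::]).
  rewrite expr1 expr2 mulrA mulrA divff// mul1r; exact: Ht.
(* Exponent 0: either no derivative and equal weights, where [f 0 = std j] applies, or one
   horizontal derivative of the last component of a horizontal field, where [df] applies. *)
- have Q0 x : partials I (model_field B (std j)) x 0 k = h k 0.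
    rewrite partials_model_field; move: ks; rewrite /s /weight_seq /h.
    case: I {s h dh sc} => [|i [|i' I]].
    + rewrite big_nil addn0 /= f0 mxE [X in _ + X]mxE !stdE.
      case: (horP j) => [|j']; case: (horP k) => [|k'];
        rewrite ?weight_max ?weight_hor// => _.
        by rewrite bil_max_l mul0r addr0.
      by rewrite hor_neq mulr0 addr0.
    + rewrite big_cons big_nil addn0 /= mxE stdE.
      case: (horP j) df => [|j'] df; case: (horP k) => [|k']; case: (horP i) => [|i'];
        rewrite ?weight_max ?weight_hor// => _.
      by rewrite df ?hor_neq// eqxx mulr1.
    + rewrite !big_cons => ks; suff : (weight k < weight k)%N by rewrite ltnn.
      rewrite {2}ks; apply: (@leq_trans (1 + (1 + (1 + 0)))).
        by rewrite ltnS /weight; case: ifP.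
      by rewrite !leq_add// weight_gt0.
  apply: filterS2 t_neq0 (dilation_cvg cK (dh k) d0) => t [t0 _] Ht x Kx.
  rewrite Q0 ks mulrA exprVn divff ?expf_neq0// mul1r; exact: Ht.
Qed.

End ModelLimit.

(** * Nilpotent approximations *)

Section Approximations.
Context {R : realType} {m : nat}.
Local Notation E := 'rV[R]_m.+1.

(** Convergence on singletons already fixes the limit, so the fields [Y] quantified in
    [is_nilpotent_approximation] are the model ones. *)
Lemma is_rescaling_limit_unique (j : 'I_m.+1) (f Y Y' : E -> E) :
  is_rescaling_limit j f Y -> is_rescaling_limit j f Y' -> Y = Y'.
Proof.
move=> [_ /(_ [::]) H] [_ /(_ [::]) H']; apply/funext => x.
have lim (Z : E -> E) :
    {family compact, (fun t => rescaled j f t) @ (0 : R)^' --> Z} ->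
    rescaled j f t x @[t --> (0 : R)^'] --> Z x.
  by move=> /fam_cvgP /(_ [set x] (@compact_set1 _ x)); rewrite uniform_set1.
exact: cvg_unique (lim _ H) (lim _ H').
Qed.

Variables (M : heisenbergManifold R m) (a : M) (U : set M).
Variable X : 'I_m.+1 -> M -> components M.
Hypotheses (Ua : U a) (fX : H_frame U X).

Lemma is_nilpotent_approximationP c mul : privileged_coordinates a X c ->
  is_nilpotent_approximation X c mul <-> mul = model_mul (frame_mx X c).
Proof.
move=> /privileged_coordinatesP[Ac ca c0 fs]; have [oU vX _ _] := fX.
have lim j : is_rescaling_limit j (in_chart c (X j))
    (model_field (frame_mx X c) (std j)).
  have [_ /(_ c Ac) sX] := vX j.
  apply: is_rescaling_limit_model (chart_image_open oU) _ sX (fs j) _.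
    by exists a.
  move=> k; case: (horP j) => [|i _]; first by rewrite eqxx.
  by rewrite bil_hor mxE.
split=> [[Y Ylim mulP]|->].
  have YE : Y = fun j => model_field (frame_mx X c) (std j).
    by apply/funext => j; exact: is_rescaling_limit_unique (Ylim j) (lim j).
  apply/funext => x; apply/funext => y; apply/mulP.
  by rewrite YE; apply/model_mulP.
by exists (fun j => model_field (frame_mx X c) (std j)) => // x y z; exact: model_mulP.
Qed.

End Approximations.

Theorem proposition6p22 (R : realType) (m : nat) (M : heisenbergManifold R m)
    (a : M) (U : set M) (X : 'I_m.+1 -> M -> components M) :
  U a -> H_frame U X ->
  exists F : 'M[R]_m -> ('rV[R]_m.+1 -> 'rV[R]_m.+1 -> 'rV[R]_m.+1),
    set_bij [set S | S^T = S] (nilpotent_approximations a X) F.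
Proof.
move=> Ua fX; have [c0 pc0] := privileged_exists Ua fX.
(* The bijection depends on the base chart [c0], to which the zero matrix corresponds. *)
exists (fun S => model_mul (frame_mx X c0 + S)); split.
- move=> S /= ST; have [c pc cE] := frame_mx_shear Ua fX pc0 ST.
  by exists c => //; apply/(is_nilpotent_approximationP Ua fX _ pc); rewrite cE.
- by move=> S S' _ _ /model_mul_inj /addrI.
- move=> mul [c pc /(is_nilpotent_approximationP Ua fX _ pc) ->].
  have [S ST cE] := frame_mx_change Ua fX pc0 pc.
  by exists S => //; rewrite cE.
Qed.
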